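(* For all $n \ge 2$ and all even $k \ge 2$, there exist at most $t(k^2)$ pairwise non-isomorphic $n$-vertex $k$-minimal trees.
   Context: Graphs are finite and simple. A set $J \subseteq V(G)$ is a distance-$k$ independent set if any two distinct vertices of $J$ are at distance at least $k+1$; a $k$-MDIS is an inclusion-wise maximal distance-$k$ independent set. An $n$-vertex tree is $k$-minimal if it has the minimum possible number of $k$-MDISs among all $n$-vertex trees. $t(m)$ denotes the number of unlabeled $m$-vertex trees, i.e. the number of isomorphism classes of trees on $m$ vertices. *)

(* Defs.v *)
From HB Require Import structures.
From mathcomp Require Import all_boot all_fingroup.

Set Implicit Arguments.
Unset Strict Implicit.
Unset Printing Implicit Defensive.

Record sgraph (T : finType) := SGraph {
  edges : {set {set T}};
  _ : [forall e in edges, #|e| == 2]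
}.

HB.instance Definition _ (T : finType) := [isSub for @edges T].
HB.instance Definition _ (T : finType) := [Finite of sgraph T by <:].

Definition adj (T : finType) (G : sgraph T) : rel T :=
  fun x y => [set x; y] \in edges G.

Definition walk_of_length (T : finType) (G : sgraph T) (d : nat) (x y : T) :=
  [exists p : d.-tuple T, path (adj G) x p && (last x p == y)].

(* The least length of a walk from x to y. A shortest walk has length less    *)
(* than #|T|; the value is #|T| when x and y lie in different components.     *)
Definition gdist (T : finType) (G : sgraph T) (x y : T) : nat :=
  find (fun d => walk_of_length G d x y) (iota 0 #|T|).

(* Vertices in different components are at infinite distance, whence the      *)
(* connect guard on gdist.                                                    *)
Definition dist_independent (T : finType) (G : sgraph T) (k : nat)
    (J : {set T}) : bool :=
  [forall x in J, forall y in J,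
     (x != y) && connect (adj G) x y ==> (k.+1 <= gdist G x y)].

Definition mdis (T : finType) (G : sgraph T) (k : nat) : {set {set T}} :=
  [set J | maxset (dist_independent G k) J].

Definition connected (T : finType) (G : sgraph T) : bool :=
  (0 < #|T|) && [forall x, forall y, connect (adj G) x y].

(* The bound on the length m of a cycle is harmless: see acyclicP.            *)
Definition acyclic (T : finType) (G : sgraph T) : bool :=
  [forall m : 'I_#|T|.+1, forall p : m.-tuple T,
     ucycleb (adj G) p ==> (m < 3)].

Definition is_tree (T : finType) (G : sgraph T) : bool :=
  connected G && acyclic G.

Definition isomorphic (T : finType) (G H : sgraph T) : bool :=
  [exists s : {perm T}, forall x, forall y,
     adj H (s x) (s y) == adj G x y].

Definition num_trees (m : nat) : nat :=
  #|equivalence_partition (@isomorphic 'I_m) [set G | is_tree G]|.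

Definition minimal_tree (n k : nat) (G : sgraph 'I_n) : bool :=
  is_tree G &&
  [forall H : sgraph 'I_n, is_tree H ==> (#|mdis G k| <= #|mdis H k|)].

Lemma adj_sym (T : finType) (G : sgraph T) : symmetric (adj G).
Proof. by move=> x y; rewrite /adj setUC. Qed.

Lemma adj_irrefl (T : finType) (G : sgraph T) : irreflexive (adj G).
Proof.
move=> x; rewrite /adj; apply/negP => xx.
by case: G xx => E /= /forall_inP hE /hE; rewrite setUid cards1.
Qed.

Lemma acyclicP (T : finType) (G : sgraph T) :
  reflect (forall p : seq T, ucycle (adj G) p -> size p < 3) (acyclic G).
Proof.
apply: (iffP forallP) => [h p /andP[cp up]|h m].
  have sp : size p < #|T|.+1 by rewrite ltnS -(card_uniqP up) max_card.
  have /forallP/(_ (in_tuple p))/implyP := h (Ordinal sp).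
  by apply; rewrite /ucycleb cp up.
apply/forallP => p; apply/implyP => cp.
by rewrite -(size_tuple p); apply: h.
Qed.

Lemma gdistP (T : finType) (G : sgraph T) (x y : T) :
  connect (adj G) x y ->
  walk_of_length G (gdist G x y) x y /\
  (forall d, walk_of_length G d x y -> gdist G x y <= d).
Proof.
move=> /connectP[p0 pp0 ->] {y}; case/shortenP: pp0 => p pp up _.
set w := fun d => walk_of_length G d x (last x p).
have hp : w (size p) by apply/existsP; exists (in_tuple p); rewrite pp eqxx.
have sp : size (x :: p) <= #|T| by rewrite -(card_uniqP up) max_card.
have hw : has w (iota 0 #|T|).
  by apply/hasP; exists (size p); rewrite ?mem_iota.
have := hw; rewrite has_find size_iota => lt_find.
split; first by have := nth_find 0 hw; rewrite nth_iota.
move=> d wd; rewrite leqNgt; apply/negP => lt_d.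
have := before_find 0 lt_d; rewrite nth_iota; last exact: ltn_trans lt_find.
by rewrite add0n /w wd.
Qed.

Lemma isomorphic_equiv (T : finType) :
  equivalence_rel (@isomorphic T).
Proof.
have refl G : isomorphic G G.
  apply/existsP; exists 1%g; apply/forallP => x; apply/forallP => y.
  by rewrite !perm1.
have sym G H : isomorphic G H -> isomorphic H G.
  move=> /existsP[s /forallP hs]; apply/existsP; exists (s^-1)%g.
  apply/forallP => x; apply/forallP => y.
  have /forallP/(_ ((s^-1)%g y))/eqP := hs ((s^-1)%g x).
  by rewrite !permKV => ->.
have trans G H K : isomorphic G H -> isomorphic H K -> isomorphic G K.
  move=> /existsP[s /forallP hs] /existsP[t /forallP ht].
  apply/existsP; exists (s * t)%g; apply/forallP => x; apply/forallP => y.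
  rewrite !permM; have /forallP/(_ (s y))/eqP -> := ht (s x).
  by have /forallP/(_ y) := hs x.
move=> G H K; split=> // GH; apply/idP/idP; last exact: trans.
exact/trans/sym.
Qed.

(* Main.v *)
Require Import Defs.
From mathcomp Require Import all_boot all_fingroup all_algebra.
From mathcomp Require Import zify lra.

Set Implicit Arguments.
Unset Strict Implicit.
Unset Printing Implicit Defensive.

(** Write [k = 2s]. The [k]-MDISs of a tree are the maximal independent sets of
    its [k]-th power, which is a chordal graph. For [n > s] the least
    possible number of them is [n + 1 - n %/ (s + 1)], and the point is that
    equality forces a rigid shape.

    Lower bound. If [E] is the family of MDISs, consider the linear system
    asking that a weight on the vertices sums to zero over every member of [E].
    Peeling off subtrees with at least [s + 1] vertices, each inside one ball of
    radius [s], shows that a solution is zero as soon as it vanishes on a set of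
    fewer than [n %/ (s + 1)] vertices ([mis_weight_determined]); hence there
    are at least [n + 1 - n %/ (s + 1)] equations. If each side of some edge
    contains two vertices at distance more than [s] from the opposite end of
    the edge, then four MDISs are linearly dependent, one equation is
    redundant, and the bound improves by one ([heavy_edge_mdis]). The spider, a
    vertex with legs of length [s + 1], one path of length [s] and possibly one
    shorter leg, attains the bound ([spider_mdis]). So a minimal tree has no
    such edge, and then some vertex [c], the centre, has only branches with at
    most one vertex farther than [s] from [c] ([exists_center]). These far
    vertices form the rim. Counting around [c] shows that a minimal tree has
    almost as many of them as there is room for: it is a near-spider
    ([few_mdis_near_spider]).

    Counting. For [s >= 2], a near-spider with more than [k ^ 2] vertices has
    too few vertices left for every branch that reaches the rim to be larger
    than a bare path. Deleting such a path loses no information, because the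
    centre remains the only vertex of eccentricity at most [s + 1]
    ([embeds_strip]). Iterating brings the order down to at most [k ^ 2], and
    from there attaching leaves brings it up to exactly [k ^ 2], injectively on
    isomorphism classes ([embeds_grow]). For [s = 1] all legs are bare paths
    and the number of legs takes two values, which are matched with the two
    trees on four vertices ([embeds_near_spider1]). *)

(** * Distances, and the two sides of an edge of a tree *)

Section Metric.
Variables (T : finType) (G : sgraph T).
Hypothesis connG : connected G.
Local Notation d := (gdist G).

Lemma connected_connect x y : connect (adj G) x y.
Proof. by case/andP: connG => _ /forallP/(_ x)/forallP/(_ y). Qed.

Lemma gdist_path x y :
  exists p, [/\ path (adj G) x p, last x p = y & size p = d x y].
Proof.
have [/existsP[p /andP[pp /eqP lp]] _] := gdistP (connected_connect x y).
by exists p; rewrite size_tuple.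
Qed.

Lemma gdist_le_path x p : path (adj G) x p -> d x (last x p) <= size p.
Proof.
move=> pp; have [_ min] := gdistP (connected_connect x (last x p)).
by apply: min; apply/existsP; exists (in_tuple p); rewrite pp eqxx.
Qed.

Lemma gdistxx x : d x x = 0.
Proof. by apply/eqP; rewrite -leqn0; apply: (@gdist_le_path x [::]). Qed.

Lemma gdist_eq0 x y : (d x y == 0) = (x == y).
Proof.
apply/eqP/eqP => [|->]; last exact: gdistxx.
by have [p [_ lp sp]] := gdist_path x y; rewrite -sp => /size0nil p0; rewrite -lp p0.
Qed.

Lemma gdist_triangle z x y : d x y <= d x z + d z y.
Proof.
have [p [pp lp <-]] := gdist_path x z; have [q [pq lq <-]] := gdist_path z y.
rewrite -size_cat -lq -lp -last_cat; apply: gdist_le_path.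
by rewrite cat_path pp lp.
Qed.

Lemma gdistC x y : d x y = d y x.
Proof.
suff le a b : d a b <= d b a by apply/eqP; rewrite eqn_leq !le.
have [p [pp lp <-]] := gdist_path b a.
have := @gdist_le_path a (rev (belast b p)).
rewrite size_rev size_belast -lp rev_path.
rewrite (eq_path (e' := adj G)) => [/(_ pp)|u v]; last exact: adj_sym.
by case: p {lp} pp => //= c p _; rewrite rev_cons last_rcons.
Qed.

Lemma gdist_adj x y : (d x y == 1) = adj G x y.
Proof.
apply/eqP/idP => [|xy].
  have [p [pp lp <-]] := gdist_path x y; case: p pp lp => [|a [|]] //=.
  by rewrite andbT => + <-.
apply/eqP; rewrite eqn_leq (@gdist_le_path x [:: y]) /= ?xy //.
by rewrite lt0n gdist_eq0; apply: contraTneq xy => ->; rewrite adj_irrefl.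
Qed.

Lemma gdist_between x y j : j <= d x y ->
  exists2 z, d x z = j & j + d z y = d x y.
Proof.
have [p [pp lp sp]] := gdist_path x y => le_j.
have := pp; rewrite -{1}(cat_take_drop j p) cat_path => /andP[p1 p2].
exists (last x (take j p)); have := gdist_le_path p1; have := gdist_le_path p2;
  rewrite -last_cat cat_take_drop lp size_drop size_takel ?sp // => d2 d1;
  have := gdist_triangle (last x (take j p)) x y; lia.
Qed.

Lemma gdist_step x y j : d x y = j.+1 -> exists2 z, adj G z y & d x z = j.
Proof.
move=> dxy; have [|z dxz dzy] := @gdist_between x y j; first by rewrite dxy.
by exists z => //; rewrite -gdist_adj; lia.
Qed.

(** In a tree, for adjacent [x] and [y], this is the component of [x] once the
    edge [xy] is removed. *)
Definition side x y := [set v | d v x < d v y].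

Lemma side_disjoint x y v : v \in side x y -> v \notin side y x.
Proof. by rewrite !inE -leqNgt => /ltnW. Qed.

(** In a tree the convex sets are the vertex sets of subtrees; speaking of
    convex subsets of one ambient tree keeps a single distance function. *)
Definition convex (U : {set T}) :=
  forall x y z, x \in U -> y \in U -> d x z + d z y = d x y -> z \in U.

Lemma convex_setI U W : convex U -> convex W -> convex (U :&: W).
Proof.
move=> cU cW x y z /setIP[xU xW] /setIP[yU yW] bz.
by rewrite inE (cU x y) // (cW x y).
Qed.

(** A shortest path between two vertices stays in a convex set that contains
    them, and its vertices are told apart by their distance to one end. *)
Lemma convex_card U x y : convex U -> x \in U -> y \in U -> d x y < #|U|.
Proof.
move=> cU xU yU; rewrite cardE -(size_iota 0 (d x y).+1) -(size_map (d x)).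
apply: uniq_leq_size => [|j]; first exact: iota_uniq.
rewrite mem_iota add0n ltnS => /= /gdist_between[z dxz dzy].
by apply/mapP; exists z; rewrite // mem_enum (cU x y) ?dxz.
Qed.

End Metric.

Section Tree.
Variables (T : finType) (G : sgraph T).
Hypothesis treeG : is_tree G.
Local Notation d := (gdist G).

Let connG : connected G. Proof. by case/andP: treeG. Qed.
Let acycG : acyclic G. Proof. by case/andP: treeG. Qed.
Let dC := gdistC connG.
Let dxx := gdistxx connG.
Let triangle := gdist_triangle connG.

Section Edge.
Variables (x y : T).
Hypothesis xy : adj G x y.

Let cut : rel T := fun a b => adj G a b && ([set a; b] != [set x; y]).

Let cut_sym : connect_sym cut.
Proof. by apply: sym_connect_sym => a b; rewrite /cut adj_sym setUC. Qed.

(* A simple path from x to y that avoids the edge xy closes up to a cycle. *)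
Let cut_disconnects : ~~ connect cut x y.
Proof.
apply/negP => /connectP[p0 pp0 ly]; case/shortenP: pp0 ly => p pp up _ ly.
have adjp : path (adj G) x p by move: pp; apply: sub_path => a b; rewrite /cut => /andP[].
have /acyclicP/(_ (x :: p)) := acycG.
rewrite /ucycle up /= rcons_path adjp -ly adj_sym xy => /(_ isT).
case: p pp up ly {adjp} => [|a [|b p]] //=.
  by move=> _ _ yx; move: xy; rewrite yx adj_irrefl.
by rewrite /cut => /andP[/andP[_ +] _] _ yx; rewrite yx eqxx.
Qed.

Let cut_cover v : connect cut x v || connect cut y v.
Proof.
have /connectP[p pp ->] := connected_connect connG x v.
suff step a : path (adj G) a p -> connect cut x a || connect cut y a ->
    connect cut x (last a p) || connect cut y (last a p).
  by apply: step pp _; rewrite connect0.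
elim: p a {pp} => [|b p IH] a //= /andP[ab pp] ha.
apply: IH pp _; case: (eqVneq [set a; b] [set x; y]) => [e|ne].
  have: b \in [set x; y] by rewrite -e !inE eqxx orbT.
  by rewrite !inE => /orP[]/eqP->; rewrite connect0 ?orbT.
have cab : connect cut a b by apply: connect1; rewrite /cut ab.
by case/orP: ha => ha; rewrite (connect_trans ha cab) ?orbT.
Qed.

(* A shortest path from the side of x to the side of y has a first edge that
   crosses, and the only crossing edge is xy. *)
Let cut_gdist u v :
  connect cut x u -> connect cut y v -> d u v = d u x + 1 + d y v.
Proof.
move=> xu yv; apply/eqP; rewrite eqn_leq; apply/andP; split.
  have := triangle x u v; have := triangle y x v.
  by move/eqP: (xy); rewrite -(gdist_adj connG) => /eqP; lia.
have [p [pp lp <-]] := gdist_path connG u v.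
elim: p u xu pp lp => [|b p IH] u xu /=.
  move=> _ uv; case/negP: cut_disconnects; apply: connect_trans xu _.
  by rewrite cut_sym uv.
move=> /andP[ub pp] lp.
case: (eqVneq [set u; b] [set x; y]) => [e|ne]; last first.
  have xb : connect cut x b.
    by apply: connect_trans xu _; apply: connect1; rewrite /cut ub.
  have := IH _ xb pp lp; have := triangle b u x.
  by move: ub; rewrite -(gdist_adj connG) => /eqP; lia.
have nuy : u != y by apply: contraNneq cut_disconnects => <-.
have: u \in [set x; y] by rewrite -e !inE eqxx.
rewrite !inE (negPf nuy) orbF => /eqP ux.
have: y \in [set u; b] by rewrite e !inE eqxx orbT.
rewrite !inE eq_sym (negPf nuy) => /eqP yb.
by have := gdist_le_path connG pp; rewrite lp -yb ux dxx; lia.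
Qed.

Let mem_side v : (v \in side G x y) = connect cut x v.
Proof.
rewrite inE; apply/idP/idP => [lt|xv]; last first.
  by rewrite (cut_gdist xv (connect0 _ y)) dxx; lia.
case/orP: (cut_cover v) => // yv.
by have := cut_gdist (connect0 _ x) yv; rewrite dxx -!(dC v); lia.
Qed.

Let mem_side' v : (v \in side G y x) = connect cut y v.
Proof.
rewrite inE; apply/idP/idP => [lt|yv]; last first.
  by have := cut_gdist (connect0 _ x) yv; rewrite dxx -!(dC v); lia.
case/orP: (cut_cover v) => // xv.
by have := cut_gdist xv (connect0 _ y); rewrite dxx; lia.
Qed.

(** Every walk between the two sides of an edge runs through that edge. All
    metric consequences of acyclicity below come from this identity. *)
Lemma gdist_across u v : u \in side G x y -> v \in side G y x ->
  d u v = d u x + 1 + d y v.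
Proof. by rewrite mem_side mem_side'; apply: cut_gdist. Qed.

Lemma side_cover v : v \notin side G x y -> v \in side G y x.
Proof. by rewrite mem_side mem_side'; have /orP[->|] := cut_cover v. Qed.

Lemma side_gdist u : u \in side G x y -> d u y = d u x + 1.
Proof.
move=> ux; rewrite (@gdist_across u y) // ?dxx; first lia.
by rewrite mem_side' connect0.
Qed.

Lemma side_self : x \in side G x y.
Proof. by rewrite mem_side connect0. Qed.

End Edge.

Lemma side_convex x y : adj G x y -> convex G (side G x y).
Proof.
move=> xy u v z us vs bz; apply/negPn/negP => /(side_cover xy) zs.
have := gdist_across xy us zs; have := gdist_across xy vs zs.
have := triangle x u v; rewrite (dC v z) (dC v x); lia.
Qed.

(** A branch at [c] is the side away from [c] of an edge [cx]. *)
Lemma branch_exists c v : v != c -> exists2 x, adj G x c & v \in side G x c.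
Proof.
move=> vc; have [|x dvx dxc] := @gdist_between _ _ connG v c (d v c).-1.
  by lia.
have d0 : d v c != 0 by rewrite gdist_eq0.
by exists x; [rewrite -gdist_adj //; lia | rewrite inE; lia].
Qed.

Lemma branch_inj c x x' v : adj G x c -> adj G x' c ->
  v \in side G x c -> v \in side G x' c -> x = x'.
Proof.
move=> xc x'c vx vx'; apply/eqP; rewrite -(gdist_eq0 connG).
have dx'c : d x' c = 1 by apply/eqP; rewrite gdist_adj.
have [/(side_gdist xc)|/(side_cover xc) x's] := boolP (x' \in side G x c).
  by rewrite (dC x' x); lia.
have := gdist_across xc vx x's; have := side_gdist x'c vx'.
by have := side_gdist xc vx; rewrite (dC c x'); lia.
Qed.

(** Two vertices of one branch can be joined without visiting [c], which saves
    the two steps between [c] and the root [x] of the branch. *)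
Lemma gdist_branch c x u v : adj G x c ->
  u \in side G x c -> v \in side G x c -> d u v + 2 <= d u c + d v c.
Proof.
move=> xc us vs; have := triangle x u v; rewrite (dC x v).
by rewrite (side_gdist xc us) (side_gdist xc vs); lia.
Qed.

Lemma gdist_branches c x u v : adj G x c ->
  u \in side G x c -> v \notin side G x c -> d u v = d u c + d v c.
Proof.
move=> xc us /(side_cover xc) vs; rewrite (gdist_across xc us vs).
by rewrite (side_gdist xc us) (dC c v).
Qed.

Lemma adj_branch c x u v : adj G x c -> u \in side G x c -> adj G u v ->
  v != c -> v \in side G x c.
Proof.
move=> xc us uv vc; apply/negPn/negP => vs.
have := gdist_branches xc us vs; move: uv vc; rewrite -gdist_adj // => /eqP ->.
rewrite -(gdist_eq0 connG); have := us; rewrite inE; lia.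
Qed.

Lemma adj_gdist_neq c u v : adj G u v -> d c u != d c v.
Proof.
move=> uv; have [us|/(side_cover uv) vs] := boolP (c \in side G u v).
  by have := side_gdist uv us; lia.
by move: (uv); rewrite adj_sym => vu; have := side_gdist vu vs; lia.
Qed.

Lemma closer_neighbor_inj c u v v' : adj G u v -> adj G u v' ->
  d c v <= d c u -> d c v' <= d c u -> v = v'.
Proof.
move=> uv uv' lev lev'.
have ne := adj_gdist_neq c uv; have ne' := adj_gdist_neq c uv'.
apply: (@branch_inj u v v' c); rewrite 1?adj_sym // !inE; lia.
Qed.

End Tree.

(** * Weights that vanish on all maximal independent sets *)

(** A family of sets whose incidence vectors span the space of all weights has
    at least as many members as there are points. *)
Lemma card_le_incidence (T : finType) (E : {set {set T}}) :
  (forall w : T -> rat,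
     (forall J, J \in E -> \sum_(v in J) w v = 0)%R -> forall v, w v = 0%R) ->
  #|T| <= #|E|.
Proof.
move=> inj; pose f (j : 'I_#|E|) : {set T} := enum_val j.
have f_onto J : J \in E -> exists j, f j = J.
  by move=> JE; exists (enum_rank_in JE J); apply: enum_rankK_in.
pose A := (\matrix_(i < #|T|, j < #|E|) (enum_val i \in f j)%:R : 'M[rat]_(_, _))%R.
suff /eqP <- : row_free A by apply: rank_leq_col.
rewrite -kermx_eq0; apply/eqP/row_matrixP => i; rewrite row0.
set u := row i _; have uA : (u *m A = 0)%R.
  by apply/sub_kermxP; rewrite row_sub.
apply/rowP => j; rewrite [RHS]mxE -(enum_valK j).
apply: (inj (fun v => u ord0 (enum_rank v))) => _ /f_onto[l <-].
have /rowP/(_ l) := uA; rewrite !mxE => uAl; rewrite -[RHS]uAl.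
rewrite [LHS](reindex (@enum_val T predT)) /=; last first.
  by exists enum_rank => x _; rewrite ?enum_valK ?enum_rankK.
rewrite [LHS]big_mkcond; apply: eq_bigr => m _.
rewrite [A _ _]mxE enum_valK.
by case: ifP; rewrite ?GRing.mulr1 ?GRing.mulr0.
Qed.

Section MaximalIndependent.
Variables (T : finType) (G : sgraph T) (k : nat).
Hypothesis connG : connected G.
Local Notation d := (gdist G).

Definition independent (J : {set T}) :=
  forall x y, x \in J -> y \in J -> d x y <= k -> x = y.

Lemma independentP J : reflect (independent J) (dist_independent G k J).
Proof.
apply: (iffP forall_inP) => [h x y xJ yJ le_k|h x xJ].
  have /forall_inP/(_ y yJ) := h x xJ.
  by rewrite connected_connect // andbT ltnNge le_k implybF negbK => /eqP.
apply/forall_inP => y yJ; rewrite connected_connect // andbT ltnNge.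
by apply/implyP; apply: contra => le_k; apply/eqP/h.
Qed.

(** The distance is that of the whole graph also when [U] is smaller, and
    maximality is stated as domination of [U]. *)
Definition mdis_in (U J : {set T}) :=
  [/\ J \subset U, independent J &
      forall u, u \in U -> exists2 y, y \in J & d u y <= k].

Lemma mdis_in_extend (U I : {set T}) : I \subset U -> independent I ->
  exists2 J, mdis_in U J & I \subset J.
Proof.
move=> IU indI; pose P (J : {set T}) := (J \subset U) && dist_independent G k J.
have PI : P I by rewrite /P IU; apply/independentP.
have [J /maxsetP[/andP[JU /independentP indJ] maxJ] IJ] := maxset_exists PI.
exists J => //; split=> // u uU.
have [/exists_inP[y yJ le_k]|/exists_inPn none] :=
  boolP [exists y in J, d u y <= k]; first by exists y.
have uJ : u \in J; last by exists u; rewrite ?gdistxx.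
have <- : u |: J = J; last by rewrite setU11.
apply: maxJ; last exact: subsetUr.
rewrite /P subUset sub1set uU JU; apply/independentP => x y.
rewrite !inE => /orP[/eqP->|xJ] /orP[/eqP->|yJ] // le_k; last exact: indJ.
  by have := none _ yJ; rewrite le_k.
by have := none _ xJ; rewrite gdistC // le_k.
Qed.

Lemma mdisP J : reflect (mdis_in setT J) (J \in mdis G k).
Proof.
rewrite inE; apply: (iffP idP) => [mJ|[_ indJ domJ]].
  have /maxsetP[indJ maxJ] := mJ; move/independentP: indJ => indJ.
  have [J' [_ indJ' domJ'] JJ'] := mdis_in_extend (subsetT J) indJ.
  by have <- // : J' = J by apply: maxJ => //; apply/independentP.
apply/maxsetP; split=> [|J' /independentP indJ' JJ'].
  exact/independentP.
apply/eqP; rewrite eqEsubset JJ' andbT; apply/subsetP => u uJ'.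
have [y yJ le_k] := domJ u (in_setT u).
by rewrite (indJ' u y _ _ le_k) // (subsetP JJ').
Qed.

Lemma mdis_in_mem (U : {set T}) u : u \in U -> exists2 J, mdis_in U J & u \in J.
Proof.
move=> uU; have [||J mJ] := @mdis_in_extend U [set u].
- by rewrite sub1set.
- by move=> x y /set1P-> /set1P->.
by rewrite sub1set; exists J.
Qed.

End MaximalIndependent.

Section Rank.
Variables (T : finType) (G : sgraph T) (s : nat).
Hypothesis treeG : is_tree G.
Local Notation d := (gdist G).
Local Notation mis := (mdis_in G s.*2).

Let connG : connected G. Proof. by case/andP: treeG. Qed.
Let dC := gdistC connG.
Let dxx := gdistxx connG.
Let triangle := gdist_triangle connG.

Local Open Scope ring_scope.

Definition vanishes_on_mis (w : T -> rat) (U : {set T}) :=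
  forall J, mis U J -> \sum_(v in J) w v = 0.

(** When one ball of radius [s] covers [U], the maximal independent subsets of
    [U] are its singletons. *)
Let vanishing_in_ball (U : {set T}) c w : (forall u, u \in U -> (d c u <= s)%N) ->
  vanishes_on_mis w U -> forall u, u \in U -> w u = 0.
Proof.
move=> ball hw u uU; have := hw [set u]; rewrite big_set1; apply.
split=> [|x y /set1P-> /set1P->|v vU] //; first by rewrite sub1set.
exists u; first exact: set11.
by have := triangle c v u; rewrite (dC v c); have := ball _ uU; have := ball _ vU; lia.
Qed.

(** Let [v0] be a vertex of [U] farthest from some [r] in [U], [c] the vertex at
    distance [s] from [v0] on the way to [r], and [D] the part of [U] hanging
    off at [c]. Then [D] lies in the ball of radius [s] about [c], and the
    vertices of [U] near to [v0] are exactly those in that ball. So when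
    [w v0 = 0], the maximal independent subsets of [U :\: D] still have
    weight zero: either they are maximal in [U], or they become so by adding
    [v0]. Once [w] is zero outside [D], any maximal independent set through [u]
    in [D] reduces to the single term [w u]. Each round adds one vertex to [S]
    and removes more than [s] vertices from [U]. *)
Lemma mis_weight_determined (U : {set T}) : convex G U -> (s < #|U|)%N ->
  exists2 S : {set T}, (s.+1 * #|S|.+1 <= #|U|)%N &
    forall w, vanishes_on_mis w U -> (forall v, v \in S -> w v = 0) ->
    forall v, v \in U -> w v = 0.
Proof.
have [m] := ubnP #|U|; elim: m U => // m IH U leU cU ltU.
have [/existsP[c /forall_inP ball]|/existsPn noball] :=
  boolP [exists c, forall u in U, d c u <= s]%N.
  exists set0; first by rewrite cards0 muln1.
  by move=> w hw _; apply: vanishing_in_ball ball hw.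
have far c : exists2 z, z \in U & (s < d c z)%N.
  have /forall_inPn[z zU] := noball c; rewrite -ltnNge; by exists z.
have /card_gt0P[r rU] : (0 < #|U|)%N by apply: leq_trans ltU.
pose v0 := [arg max_(v > r in U) d r v]%N.
have [v0U max_v0] : v0 \in U /\ forall v, v \in U -> (d r v <= d r v0)%N.
  by rewrite /v0; case: arg_maxnP.
have s_v0 : (s < d r v0)%N.
  by have [z zU] := far r; have := max_v0 z zU; lia.
have [c drc dcv0] : exists2 c, (d r c + s)%N = d r v0 & d c v0 = s.
  have [|c drc dcv0] := @gdist_between _ _ connG r v0 (d r v0 - s).
    exact: leq_subr.
  by exists c; lia.
have cU' : c \in U by apply: (cU r v0) => //; rewrite dcv0.
have [p pc drp] : exists2 p, adj G p c & (d r p).+1 = d r c.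
  have [|p pc drp] := @gdist_step _ _ connG r c (d r c).-1; first by lia.
  by exists p => //; lia.
have cp : adj G c p by rewrite adj_sym.
have dpc : d p c = 1%N by apply/eqP; rewrite gdist_adj.
have r_p : r \in side G p c by rewrite inE; lia.
have v0_c : v0 \in side G c p.
  rewrite inE (dC v0 c) dcv0 (dC v0 p) -(ltn_add2l (d r p)).
  by apply: leq_trans (triangle p r v0); rewrite -drc -drp addSn.
have d_r v : v \in side G c p -> d r v = (d r c + d c v)%N.
  move=> vc; rewrite (dC r v) (gdist_across treeG cp vc r_p) (dC v c) (dC p r).
  by move: drp dpc; clear; lia.
(* D is the peeled part and U' the remaining subtree. *)
pose D := U :&: side G c p; pose U' := U :&: side G p c.
have U'E : U' = U :\: side G c p.
  apply/setP => v; rewrite in_setI in_setD andbC; congr (_ && _).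
  apply/idP/idP => [vp|/(side_cover treeG cp)//].
  exact: side_disjoint.
have cardU : (#|D| + #|U'|)%N = #|U| by rewrite U'E cardsID.
have v0D : v0 \in D by rewrite in_setI v0U.
have cD : c \in D by rewrite in_setI cU' (side_self treeG cp).
have D_ge : (s < #|D|)%N.
  rewrite -dcv0; apply: (convex_card connG (U := D)) => //.
  by apply: convex_setI => //; apply: side_convex.
have D_ball v : v \in D -> (d c v <= s)%N.
  case/setIP=> vU /d_r drv.
  by rewrite -(leq_add2l (d r c)) -drv drc; apply: max_v0.
have v0_U' v : v \in U' -> d v0 v = (s + d c v)%N.
  case/setIP=> _ vp; rewrite (gdist_across treeG cp v0_c vp) (dC v0) dcv0.
  by rewrite (dC c v) (side_gdist treeG pc vp) (dC p v); clear; lia.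
have U'_gt : (s < #|U'|)%N.
  have [z zU dcz] := far c.
  have zU' : z \in U'.
    rewrite U'E in_setD zU andbT; apply/negP => zc.
    by have := D_ball z; rewrite in_setI zU zc leqNgt dcz => /(_ isT).
  have pU' : p \in U'.
    rewrite in_setI (side_self treeG pc) andbT.
    apply: (cU r v0) => //; apply/eqP; rewrite eqn_leq triangle andbT.
    have := triangle c p v0; move: drc drp dpc dcv0; clear; lia.
  have /setIP[_ zp] := zU'.
  have := convex_card connG (convex_setI cU (side_convex treeG pc)) pU' zU'.
  apply: leq_trans; move: dcz; rewrite (dC c) (side_gdist treeG pc zp) addn1.
  by rewrite (dC p) ltnS.
have [|S' leS' hS'] := IH U' _ (convex_setI cU (side_convex treeG pc)) U'_gt.
  by move: leU cardU D_ge; clear; lia.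
exists (v0 |: S').
  rewrite -cardU; apply: leq_trans (leq_add D_ge leS').
  by rewrite -mulnS leq_mul2l cardsU1 addnC; case: (v0 \notin S'); clear; lia.
move=> w hw wS.
have w_v0 : w v0 = 0 by apply: wS; rewrite setU11.
have disj v : v \in U' -> v \in D = false.
  by rewrite U'E !inE => /andP[/negPf->]; rewrite andbF.
have wU' : forall v, v \in U' -> w v = 0.
  apply: hS' => [J [JU' indJ domJ]|v vS']; last by apply: wS; rewrite setU1r.
  have JU : J \subset U by apply: subset_trans JU' _; rewrite subsetIl.
  have [/exists_inP[u uJ du]|/exists_inPn none] :=
    boolP [exists u in J, d u c <= s]%N.
    apply: hw; split=> // v vU; have [vD|vD] := boolP (v \in D).
      exists u => //; apply: leq_trans (triangle c v u) _.
      by rewrite -addnn leq_add // 1?(dC v) 1?(dC c u) ?D_ball.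
    by apply: domJ; rewrite U'E in_setD vU andbT; move: vD; rewrite in_setI vU.
  have v0J : v0 \notin J.
    by apply/negP => /(subsetP JU')/disj; rewrite v0D.
  have v0far y : y \in J -> (s.*2 < d v0 y)%N.
    move=> yJ; rewrite (v0_U' y (subsetP JU' y yJ)) -addnn ltn_add2l dC ltnNge.
    exact: none.
  have := hw (v0 |: J); rewrite big_setU1 //= w_v0 GRing.add0r; apply.
  split=> [|x y|v vU].
  - by rewrite subUset sub1set v0U.
  - case/setU1P=> [->|xJ] /setU1P[->|yJ] //.
    + by rewrite leqNgt v0far.
    + by rewrite dC leqNgt v0far.
    + exact: indJ.
  have [vD|vD] := boolP (v \in D).
    exists v0; first exact: setU11.
    apply: leq_trans (triangle c v v0) _.
    by rewrite -addnn dcv0 leq_add2r dC D_ball.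
  have [|y yJ dvy] := domJ v; last by exists y => //; apply: setU1r.
  by rewrite U'E in_setD vU andbT; move: vD; rewrite in_setI vU.
move=> u uU; have [uD|uD] := boolP (u \in D); last first.
  by apply: wU'; rewrite U'E in_setD uU andbT; move: uD; rewrite in_setI uU.
have [J mJ uJ] := mdis_in_mem s.*2 connG uU.
have := hw J mJ; rewrite (big_setD1 u) //= big1 ?GRing.addr0 // => v.
case/setD1P=> vu vJ; apply: wU'; have [JU indJ _] := mJ.
rewrite U'E in_setD (subsetP JU) // andbT; apply: contra vu => vc.
apply/eqP/indJ => //; apply: leq_trans (triangle c v u) _.
by rewrite -addnn leq_add ?D_ball // dC D_ball // in_setI (subsetP JU).
Qed.


End Rank.

(** * Edges with heavy branches on both sides *)

Section HeavyEdge.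
Variables (T : finType) (G : sgraph T) (s : nat).
Hypotheses (treeG : is_tree G) (s_gt0 : 0 < s).
Local Notation d := (gdist G).
Local Notation mis := (mdis_in G s.*2).

Let connG : connected G. Proof. by case/andP: treeG. Qed.
Let dC := gdistC connG.
Let dxx := gdistxx connG.
Let triangle := gdist_triangle connG.

(** A branch is heavy when this set has at least two elements. *)
Definition beyond x y := [set v in side G x y | s < d v y].

Lemma beyondE x y v : adj G x y ->
  (v \in beyond x y) = (v \in side G x y) && (s <= d v x).
Proof.
move=> xy; rewrite inE; case: (boolP (v \in _)) => //= vx.
by rewrite (side_gdist treeG xy vx) addn1 ltnS.
Qed.

(** A heavy branch contains two vertices near to each other just beyond the
    ball of radius [s] about [y]: either two vertices at distance [s] from [x],
    or one such vertex and a neighbour one step farther away. *)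
Lemma beyond_conflict x y : adj G x y -> 1 < #|beyond x y| ->
  exists t1 t2, [/\ [/\ t1 \in beyond x y, t2 \in beyond x y & t1 != t2],
    d t1 t2 <= s.*2, d x t1 <= s.+1 & d x t2 <= s.+1].
Proof.
move=> xy /card_gt1P[a [b [aB bB ab]]].
wlog le_ba : a b aB bB ab / d x b <= d x a.
  move=> wl; case: (leqP (d x b) (d x a)) => [|/ltnW]; first exact: wl.
  by apply: wl; rewrite 1?eq_sym.
have [ax axs] : a \in side G x y /\ s <= d x a.
  by move: aB; rewrite beyondE // (dC x) => /andP[].
have [bx bxs] : b \in side G x y /\ s <= d x b.
  by move: bB; rewrite beyondE // (dC x) => /andP[].
have [le_as|lt_sa] := leqP (d x a) s.
  exists a, b; split=> //; last 2 first.
  - exact: leq_trans le_as _.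
  - by apply: leq_trans le_ba _; apply: leq_trans le_as _.
  apply: leq_trans (triangle x a b) _; rewrite (dC a x) -addnn leq_add //.
  exact: leq_trans le_as.
have cx : convex G (side G x y) by apply: side_convex.
have xx := side_self treeG xy.
have [t1 xt1 t1a] := gdist_between connG lt_sa.
have t1x : t1 \in side G x y by apply: (cx x a) => //; rewrite xt1.
have [|t2 xt2 t21] := @gdist_between _ _ connG x t1 s; first by rewrite xt1.
have t2x : t2 \in side G x y by apply: (cx x t1) => //; rewrite xt2.
have d21 : d t2 t1 = 1 by move: xt1 t21; clear; lia.
exists t1, t2; split.
- split; first by rewrite beyondE // t1x (dC _ x) xt1 ltnW.
    by rewrite beyondE // t2x (dC _ x) xt2 /=.
  by apply/eqP => e; move: xt1; rewrite e xt2; clear; lia.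
- by rewrite dC d21 double_gt0.
- by rewrite xt1.
- by rewrite xt2 ltnW.
Qed.

(** The two conflicting vertices of [beyond_conflict] dominate the vertices of
    the side at distance less than [s] from [x]. So a maximal independent set
    through either of them dominates the whole side and can be combined freely
    with any such set for the other end of the edge. *)
Lemma beyond_two_mis x y : adj G x y -> 1 < #|beyond x y| ->
  exists I1 I2 : {set T}, [/\ mis (beyond x y) I1, mis (beyond x y) I2,
    ~~ (I2 \subset I1),
    forall u, u \in side G x y -> exists2 v, v \in I1 & d u v <= s.*2 &
    forall u, u \in side G x y -> exists2 v, v \in I2 & d u v <= s.*2].
Proof.
move=> xy /(beyond_conflict xy)[t1 [t2 [[t1B t2B t12] le12 le1 le2]]].
have [I1 mI1 t1I] := mdis_in_mem s.*2 connG t1B.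
have [I2 mI2 t2I] := mdis_in_mem s.*2 connG t2B.
have dom I t : mis (beyond x y) I -> t \in I -> d x t <= s.+1 ->
    forall u, u \in side G x y -> exists2 v, v \in I & d u v <= s.*2.
  move=> [_ _ domI] tI le_t u ux; have [le_s|lt_s] := leqP s (d u x).
    by apply: domI; rewrite beyondE // ux.
  exists t => //; apply: leq_trans (triangle x u t) _.
  by rewrite -addnn -ltnS -addSn -addnS leq_add.
exists I1, I2; split=> //; [|exact: dom mI1 t1I _|exact: dom mI2 t2I _].
apply/negP => /subsetP/(_ t2 t2I) t2I1; case/negP: t12.
by have [_ indI1 _] := mI1; apply/eqP/indI1.
Qed.

Lemma mis_across x y (I I' : {set T}) : adj G x y ->
  mis (beyond x y) I -> mis (beyond y x) I' ->
  (forall u, u \in side G x y -> exists2 v, v \in I & d u v <= s.*2) ->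
  (forall u, u \in side G y x -> exists2 v, v \in I' & d u v <= s.*2) ->
  mis setT (I :|: I').
Proof.
move=> xy [IB indI _] [IB' indI' _] domI domI'; have yx := xy; rewrite adj_sym in yx.
have apart u v : u \in I -> v \in I' -> s.*2 < d u v.
  move=> /(subsetP IB); rewrite beyondE // => /andP[ux us].
  move=> /(subsetP IB'); rewrite beyondE // => /andP[vy vs].
  rewrite (gdist_across treeG xy ux vy) (dC y v) addn1 -addnn addSn ltnS.
  exact: leq_add.
split=> [|u v|u _]; first exact: subsetT.
- case/setUP=> uI /setUP[vI|vI]; try exact: indI; try exact: indI'.
    by rewrite leqNgt apart.
  by rewrite dC leqNgt apart.
- have [/domI|/(side_cover treeG xy)/domI'] := boolP (u \in side G x y).
    by case=> v vI; exists v => //; rewrite inE vI.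
  by case=> v vI; exists v => //; rewrite inE vI orbT.
Qed.

(** The four combinations of two maximal independent sets on either side of
    the edge are linearly dependent, hence one equation is redundant in the
    linear system that determines the weights. *)
Lemma heavy_edge_mdis x y : adj G x y -> 1 < #|beyond x y| -> 1 < #|beyond y x| ->
  s < #|T| -> #|T|.+1 < #|mdis G s.*2| + #|T| %/ s.+1.
Proof.
move=> xy Bxy Byx ltT; have yx := xy; rewrite adj_sym in yx.
have [I1 [I2 [mI1 mI2 I21 dom1 dom2]]] := beyond_two_mis xy Bxy.
have [I1' [I2' [mI1' mI2' I21' dom1' dom2']]] := beyond_two_mis yx Byx.
have m11 := mis_across xy mI1 mI1' dom1 dom1'.
have m12 := mis_across xy mI1 mI2' dom1 dom2'.
have m21 := mis_across xy mI2 mI1' dom2 dom1'.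
have m22 := mis_across xy mI2 mI2' dom2 dom2'.
have disj I I' : mis (beyond x y) I -> mis (beyond y x) I' -> [disjoint I & I'].
  move=> [IB _ _] [IB' _ _]; rewrite disjoints_subset; apply/subsetP => v.
  move=> /(subsetP IB); rewrite beyondE // => /andP[vx _]; rewrite in_setC.
  apply: contra (side_disjoint vx) => /(subsetP IB').
  by rewrite beyondE // => /andP[].
have sepL I I' : I1 :|: I1' = I :|: I' -> mis (beyond x y) I ->
    I \subset I1.
  move=> e mI; apply/subsetP => v vI.
  have: v \in I1 :|: I1' by rewrite e inE vI.
  by case/setUP=> // vI'; have := disjointFr (disj _ _ mI mI1') vI; rewrite vI'.
have sepR I I' : I1 :|: I1' = I :|: I' -> mis (beyond y x) I' ->
    I' \subset I1'.
  move=> e mI; apply/subsetP => v vI.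
  have: v \in I1 :|: I1' by rewrite e inE vI orbT.
  by case/setUP=> // vI'; have := disjointFr (disj _ _ mI1 mI) vI'; rewrite vI.
have cT : convex G setT by move=> *; rewrite inE.
rewrite -cardsT in ltT.
have [S leS hS] := mis_weight_determined treeG cT ltT.
pose E := mdis G s.*2 :\ (I1 :|: I1').
have leT : #|T| <= #|E :|: [set [set v] | v in S]|.
  apply: card_le_incidence => w hw v; apply: (hS w) => [J|u uS|//]; last first.
    have := hw [set u]; rewrite big_set1; apply.
    by apply/setUP; right; apply/imset_f.
  have small J' : mis setT J' -> J' != I1 :|: I1' -> (\sum_(v in J') w v = 0)%R.
    move=> mJ' ne; apply: hw; apply/setUP; left; rewrite in_setD1 ne.
    exact/mdisP.
  move=> mJ; have [->|ne] := eqVneq J (I1 :|: I1'); last exact: small.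
  have ne12 : I1 :|: I2' != I1 :|: I1'.
    by apply: contra I21' => /eqP/esym/sepR; apply.
  have ne21 : I2 :|: I1' != I1 :|: I1'.
    by apply: contra I21 => /eqP/esym/sepL; apply.
  have ne22 : I2 :|: I2' != I1 :|: I1'.
    by apply: contra I21 => /eqP/esym/sepL; apply.
  have := small _ m12 ne12; have := small _ m21 ne21; have := small _ m22 ne22.
  have sumU I I' : mis (beyond x y) I -> mis (beyond y x) I' ->
      (\sum_(v in I :|: I') w v = \sum_(v in I) w v + \sum_(v in I') w v)%R.
    move=> mI mI'; rewrite -bigU ?disj //=.
    by apply: eq_bigl => z; rewrite !inE.
  by rewrite !sumU //; lra.
have := leq_trans leT (leq_card_setU _ _).1.
rewrite card_imset; last exact: set1_inj.
have E1 : #|E|.+1 = #|mdis G s.*2|.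
  by rewrite (cardsD1 (I1 :|: I1') (mdis G s.*2)) (introT (mdisP _ connG _) m11).
have : #|S|.+1 <= #|T| %/ s.+1 by rewrite leq_divRL // mulnC -cardsT.
by move: E1; clear; lia.
Qed.

(** Take a heavy branch with the fewest vertices, rooted at [x]. A heavy branch
    at [x] itself cannot be smaller, so it would have to lead back through the
    same edge. *)
Lemma exists_center (r : T) :
  (forall x y, adj G x y -> 1 < #|beyond x y| -> #|beyond y x| <= 1) ->
  exists c, forall x, adj G x c -> #|beyond x c| <= 1.
Proof.
move=> light.
pose heavy (e : T * T) := adj G e.1 e.2 && (1 < #|beyond e.1 e.2|).
have [/existsP[e0 he0]|/existsPn none] := boolP [exists e, heavy e]; last first.
  by exists r => x xr; have := none (x, r); rewrite /heavy /= xr -leqNgt.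
case: (@arg_minnP _ e0 heavy (fun e => #|side G e.1 e.2|) he0) => -[x c].
case/andP => /= xc hxc min; have cx := xc; rewrite adj_sym in cx.
exists x => y yx; rewrite leqNgt; apply/negP => hyx.
have [yc|yc] := eqVneq y c.
  by have := light x c xc hxc; rewrite -{1}yc leqNgt hyx.
have := min (y, x); rewrite /heavy /= yx hyx leqNgt => /(_ isT)/negP; apply.
have yxs : y \in side G x c.
  by apply: (adj_branch treeG xc (side_self treeG xc) _ yc); rewrite adj_sym.
apply: proper_card; apply/properP; split; last first.
  exists x; rewrite ?side_self //; apply: side_disjoint.
  by apply: side_self; rewrite // adj_sym.
apply/subsetP => v vy; apply/negPn/negP => /(side_cover treeG xc) vc.
by case/eqP: yc; apply: (branch_inj treeG yx cx vy vc).
Qed.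

End HeavyEdge.

(** * Trees whose branches at a centre have at most one far vertex *)

Section Centre.
Variables (T : finType) (G : sgraph T) (s : nat) (c : T).
Hypotheses (treeG : is_tree G) (s_gt0 : 0 < s).
Local Notation d := (gdist G).

Let connG : connected G. Proof. by case/andP: treeG. Qed.
Let dC := gdistC connG.
Let dxx := gdistxx connG.
Let triangle := gdist_triangle connG.

Definition rim := [set v | s < d v c].

(** A vertex at distance [s] from [c] that no vertex of the rim is near to;
    it keeps the rim from being a maximal independent set. *)
Definition open_rim :=
  [exists u, (d u c == s) && [forall r in rim, s.*2 < d u r]].

Definition centre := forall x, adj G x c -> #|beyond G s x c| <= 1.

Hypothesis centre_c : centre.

Lemma beyond_rim x : beyond G s x c = rim :&: side G x c.
Proof. by apply/setP => v; rewrite !inE andbC. Qed.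

Lemma mem_beyond x r : r \in rim -> r \in side G x c -> r \in beyond G s x c.
Proof. by move=> rR rx; rewrite beyond_rim in_setI rR. Qed.

Lemma rim_inj x r r' : adj G x c -> r \in rim -> r' \in rim ->
  r \in side G x c -> r' \in side G x c -> r = r'.
Proof.
move=> xc rR r'R rx r'x; apply: (card_le1_eqP (centre_c xc));
  by rewrite ?mem_beyond.
Qed.

Lemma rim_neq r : r \in rim -> r != c.
Proof. by rewrite inE; apply: contraTneq => ->; rewrite dxx. Qed.

(** A rim vertex any farther away would bring its predecessor on the way to
    [c] into the rim of the same branch. *)
Lemma rim_gdist r : r \in rim -> d r c = s.+1.
Proof.
move=> rR; have [x xc rx] := branch_exists treeG (rim_neq rR).
have := rR; rewrite inE => lt_s; apply/eqP; rewrite eqn_leq lt_s andbT.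
rewrite leqNgt; apply/negP => far.
have [|z zr dcz] := @gdist_step _ _ connG c r (d c r).-1.
  by rewrite dC prednK // (leq_trans _ lt_s).
have lt_z : s < d z c by rewrite dC dcz dC; move: far; clear; lia.
have zc : z != c by apply: contraTneq lt_z => ->; rewrite dxx.
have zx : z \in side G x c.
  by apply: (adj_branch treeG xc rx _ zc); rewrite adj_sym.
have zR : z \in rim by rewrite inE.
have zr' := rim_inj xc rR zR rx zx.
by move: zr; rewrite -zr' adj_irrefl.
Qed.

Lemma sum_branches (A : {set T}) :
  c \notin A -> \sum_(x | adj G x c) #|A :&: side G x c| = #|A|.
Proof.
move=> cA; pose br v := odflt c [pick x | adj G x c && (v \in side G x c)].
have brP v : v \in A -> adj G (br v) c && (v \in side G (br v) c).
  move=> vA; have [|x xc vx] := @branch_exists _ _ treeG c v.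
    by apply: contraNneq cA => <-.
  by rewrite /br; case: pickP => //= /(_ x); rewrite xc vx.
rewrite -[RHS]sum1_card [RHS](partition_big br (fun x => adj G x c)) /=; last first.
  by move=> v vA; case/andP: (brP v vA).
apply: eq_bigr => x xc; rewrite -sum1_card; apply: eq_bigl => v.
rewrite in_setI; case: (boolP (v \in A)) => //= vA; have /andP[bc vb] := brP v vA.
apply/idP/eqP => [vx|<-] //; exact: (branch_inj treeG bc xc vb vx).
Qed.

Lemma branch_card x : adj G x c -> beyond G s x c != set0 ->
  s < #|side G x c|.
Proof.
move=> xc /set0Pn[v]; rewrite beyondE // => /andP[vx le_s].
have := convex_card connG (side_convex treeG xc) (side_self treeG xc) vx.
by apply: leq_trans; rewrite ltnS dC.
Qed.

(** Branches are disjoint, and an open rim comes with a further branch of at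
    least [s] vertices that does not reach the rim. *)
Lemma centre_card q :
  (forall x, adj G x c -> beyond G s x c != set0 -> q <= #|side G x c|) ->
  (#|rim| * q + open_rim * s).+1 <= #|T|.
Proof.
move=> hq; have cC : c \notin [set~ c] by rewrite !inE negbK.
have cR : c \notin rim by rewrite inE dxx.
have -> : #|T| = #|[set~ c]|.+1.
  by rewrite cardsC1 prednK //; apply/card_gt0P; exists c.
rewrite ltnS -(sum_branches cC) -(sum_branches cR) big_distrl /=.
have sideE x : adj G x c -> [set~ c] :&: side G x c = side G x c.
  move=> xc; apply/setIidPr/subsetP => v; rewrite !inE.
  by apply: contraTneq => ->; rewrite dxx.
have leq_branch x : adj G x c -> #|rim :&: side G x c| * q <= #|side G x c|.
  move=> xc; rewrite -beyond_rim.
  have [->|B0] := eqVneq (beyond G s x c) set0; first by rewrite cards0.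
  have := centre_c xc; have := hq x xc B0.
  by case: #|beyond G s x c| => [|[|]] // + _; rewrite mul1n.
have [/existsP[u /andP[/eqP duc /forall_inP far]]|_] := boolP open_rim;
  last first.
  rewrite mul0n addn0; apply: leq_sum => x xc.
  by rewrite sideE // leq_branch.
rewrite mul1n.
have [|x xc ux] := @branch_exists _ _ treeG c u.
  by rewrite -(gdist_eq0 connG) duc -lt0n.
rewrite [X in X + _](bigD1 x) //= [X in _ <= X](bigD1 x) //= addnAC leq_add //.
  have -> : rim :&: side G x c = set0.
    apply/setP => r; rewrite in_set0 in_setI; apply/negP => /andP[rR rx].
    have := far r rR; have := gdist_branch treeG xc ux rx.
    by rewrite duc (rim_gdist rR); clear; lia.
  rewrite cards0 sideE // -duc dC (leq_trans _ (leqnn _)) //.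
  have := convex_card connG (side_convex treeG xc) (side_self treeG xc) ux.
  by rewrite (dC c u) (side_gdist treeG xc ux) addn1 dC.
by apply: leq_sum => y /andP[yc _]; rewrite sideE // leq_branch.
Qed.

(** The vertices outside the rim are pairwise near, so each of them lies in a
    set of its own. When the rim is not open, it dominates all of them, and
    extending it gives one more set. *)
Lemma centre_mdis : #|T| <= #|mdis G s.*2| + #|rim| /\
  (rim != set0 -> ~~ open_rim -> #|T| < #|mdis G s.*2| + #|rim|).
Proof.
pose f u := odflt set0 [pick J in mdis G s.*2 | u \in J].
have fP u : f u \in mdis G s.*2 /\ u \in f u.
  rewrite /f; case: pickP => [J /andP[] //|none].
  have [J mJ uJ] := mdis_in_mem s.*2 connG (in_setT u).
  by have := none J; rewrite uJ andbT => /negP[]; apply/mdisP.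
have f_inj : {in ~: rim &, injective f}.
  move=> u v; rewrite !inE -!leqNgt => du dv fuv.
  have [/(mdisP _ connG)[_ ind _] uJ] := fP u.
  apply: ind => //; first by rewrite fuv; have [] := fP v.
  by apply: leq_trans (triangle c u v) _; rewrite (dC c v) -addnn leq_add.
have fsub : f @: (~: rim) \subset mdis G s.*2.
  by apply/subsetP => J /imsetP[u _ ->]; have [] := fP u.
have cardT : #|T| = #|f @: (~: rim)| + #|rim|.
  by rewrite card_in_imset // addnC cardsC.
rewrite cardT !leq_add2r; split; first exact: subset_leq_card.
case/set0Pn=> r0 r0R /existsPn noopen; rewrite ltn_add2r.
have indR : independent G s.*2 rim.
  move=> r r' rR r'R le_k; have [x xc rx] := branch_exists treeG (rim_neq rR).
  apply: (rim_inj xc rR r'R rx); apply: contraTT le_k => r'x.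
  by rewrite (gdist_branches treeG xc rx r'x) !rim_gdist // -ltnNge; clear; lia.
have [J mJ RJ] := mdis_in_extend connG (subsetT rim) indR.
have [_ indJ _] := mJ.
apply: proper_card; apply/properP; split=> //; exists J; first exact/mdisP.
apply/imsetP => -[u uR JE]; have uJ : u \in J by rewrite JE; have [] := fP u.
suff [r rR dur] : exists2 r, r \in rim & d u r <= s.*2.
  by move: uR; rewrite in_setC (indJ u r) ?rR // (subsetP RJ).
move: uR; rewrite !inE -leqNgt leq_eqVlt => /orP[du|du].
  have := noopen u; rewrite du /= => /forall_inPn[r rR].
  by rewrite -leqNgt; exists r.
exists r0 => //; apply: leq_trans (triangle c u r0) _.
by rewrite (dC c) (rim_gdist r0R) -addnn addnS -addSn leq_add.
Qed.

End Centre.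

(** The inequality says that [n - #|rim|], plus one if the rim is not open, is
    at most [n + 1 - n %/ s.+1]: the lower bound [centre_mdis] leaves no other
    possibility for minimal trees. *)
Definition near_spider (T : finType) (s : nat) (G : sgraph T) (c : T) :=
  [/\ is_tree G, centre G s c &
      #|T| %/ s.+1 + ~~ open_rim G s c <= #|rim G s c|.+1].

Lemma few_mdis_near_spider (T : finType) (s : nat) (G : sgraph T) :
  is_tree G -> 0 < s -> s.+1.*2 <= #|T| ->
  #|mdis G s.*2| + #|T| %/ s.+1 <= #|T|.+1 -> exists c, near_spider s G c.
Proof.
move=> treeG s_gt0 leT few.
have ltT : s < #|T| by move: leT; clear; lia.
have /card_gt0P[t _] : 0 < #|T| by apply: leq_trans ltT.
have [|c centre_c] := @exists_center _ _ s treeG t.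
  move=> x y xy Bxy; rewrite leqNgt; apply/negP => Byx.
  have := heavy_edge_mdis treeG s_gt0 xy Bxy Byx ltT.
  by rewrite ltnNge few.
exists c; split=> //; have [ge ge1] := centre_mdis treeG centre_c.
have two : 2 <= #|T| %/ s.+1 by rewrite leq_divRL // mul2n.
have R0 : rim G s c != set0.
  rewrite -card_gt0; move: ge few two; clear; lia.
have := ge1 R0; case: (open_rim G s c) => /=.
  by move: ge few; clear; lia.
move=> /(_ isT); move: few; move: (_ %/ _) #|rim G s c| #|mdis G _| => f r m.
by move: #|T| => n; clear; lia.
Qed.

(** * Graph isomorphisms, subtrees and grafted paths *)

Definition rel_iso (A B : finType) (e : rel A) (e' : rel B) (f : A -> B) :=
  bijective f /\ forall x y, e' (f x) (f y) = e x y.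

Lemma rel_iso_inv (A B : finType) (e : rel A) (e' : rel B) f :
  rel_iso e e' f -> exists2 g, rel_iso e' e g & cancel f g /\ cancel g f.
Proof.
move=> [[g fK gK] ef]; exists g => //; split=> [|x y]; first by exists f.
by rewrite -ef !gK.
Qed.

Lemma rel_iso_comp (A B C : finType) (e : rel A) (e' : rel B) (e'' : rel C) f g :
  rel_iso e e' f -> rel_iso e' e'' g -> rel_iso e e'' (g \o f).
Proof.
by move=> [fb ef] [gb eg]; split=> [|x y /=]; [apply: bij_comp | rewrite eg].
Qed.

Lemma isomorphicP (T : finType) (G H : sgraph T) :
  reflect (exists f, rel_iso (adj G) (adj H) f) (isomorphic G H).
Proof.
apply: (iffP existsP) => [[p /forallP hp]|[f [fb ef]]].
  exists p; split=> [|x y]; first exact: injF_bij perm_inj.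
  by have /forallP/(_ y)/eqP := hp x.
exists (perm (bij_inj fb)); apply/forallP => x; apply/forallP => y.
by rewrite !permE ef.
Qed.

Section RelGraph.
Variables (T : finType) (e : rel T).

Let edge_set := [set E : {set T} |
  [exists x, exists y, [&& x != y, e x y & E == [set x; y]]]].

Fact rel_graph_subproof : [forall E in edge_set, #|E| == 2].
Proof.
apply/forall_inP => E; rewrite inE => /existsP[x /existsP[y /and3P[xy _ /eqP->]]].
by rewrite cards2 xy.
Qed.

Definition rel_graph := SGraph rel_graph_subproof.

Lemma adj_rel_graph : symmetric e -> irreflexive e -> adj rel_graph =2 e.
Proof.
move=> sym irr x y; rewrite /adj inE; apply/existsP/idP => [[a]|xy]; last first.
  exists x; apply/existsP; exists y; rewrite xy eqxx !andbT.
  by apply: contraTneq xy => ->; rewrite irr.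
case/existsP=> b /and3P[ab eab /eqP/setP E].
have := E a; have := E b; rewrite !inE !eqxx orbT /=.
case/orP=> /eqP eb; case/orP=> /eqP ea; subst => //; try by rewrite eqxx in ab.
by rewrite sym.
Qed.

End RelGraph.

Section TreeCriteria.
Variables (T : finType) (G : sgraph T).

Lemma connected_root r : (forall x, connect (adj G) r x) -> connected G.
Proof.
move=> hr; apply/andP; split; first by apply/card_gt0P; exists r.
apply/forallP => x; apply/forallP => y; apply: connect_trans (hr y).
by rewrite (sym_connect_sym (@adj_sym _ G)).
Qed.

(** A vertex of maximal rank on a cycle has two neighbours of no greater rank
    there. *)
Lemma acyclic_rank (rank : T -> nat) :
  (forall x y y', adj G x y -> adj G x y' ->
     rank y <= rank x -> rank y' <= rank x -> y = y') -> acyclic G.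
Proof.
move=> uniq_le; apply/acyclicP => p /andP[cp up]; rewrite ltnNge; apply/negP => p3.
have [x0 x0p] : exists x0, x0 \in p.
  by case: p p3 {cp up} => // a p _; exists a; rewrite mem_head.
case: (@arg_maxnP _ x0 (mem p) rank x0p) => x xp max.
have [i q rotE] := rot_to xp.
have [cq uq q3] : [/\ path.cycle (adj G) (x :: q), uniq (x :: q) & 1 < size q].
  by rewrite -rotE rot_cycle rot_uniq cp up -ltnS -[(size q).+1]/(size (x :: q)) -rotE size_rot.
have le_x y : y \in q -> rank y <= rank x.
  by move=> yq; apply: max; rewrite -[mem p y]/(y \in p) -(mem_rot i) rotE inE yq orbT.
case: q cq uq q3 le_x {rotE} => [|y [|z q]] //=.
rewrite rcons_path /= => /and3P[xy _ /andP[_ lx]] /and3P[_ yq _] _ le_x.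
have lq : last z q \in z :: q by apply: mem_last.
suff yl : y = last z q by move: yq; rewrite yl lq.
apply: (uniq_le x); rewrite ?[adj G x (last z q)]adj_sym //.
  by apply: le_x; rewrite mem_head.
by apply: le_x; rewrite inE lq orbT.
Qed.

End TreeCriteria.

(** An induced subgraph on a convex set is isometrically embedded, hence again
    a tree. The embedding is a function so that the subtree can be relabelled
    at the same time. *)
Section Subtree.
Variables (T T' : finType) (G : sgraph T) (G' : sgraph T') (i : T' -> T).
Hypotheses (treeG : is_tree G) (i_inj : injective i).
Hypothesis adj_i : forall a b, adj G (i a) (i b) = adj G' a b.
Hypothesis i_convex : convex G [set i a | a in T'].
Hypothesis T'_gt0 : 0 < #|T'|.

Let connG : connected G. Proof. by case/andP: treeG. Qed.

Let lift_path a b : exists p,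
  [/\ path (adj G') a p, last a p = b & size p = gdist G (i a) (i b)].
Proof.
move dab: (gdist G (i a) (i b)) => m; elim: m b dab => [|m IH] b dab.
  have /eqP/i_inj ab : i a == i b by rewrite -(gdist_eq0 connG) dab.
  by exists [::].
have [z zb daz] := gdist_step connG dab.
have /imsetP[b' _ zE] : z \in [set i a | a in T'].
  have mem_i c : i c \in [set i a | a in T'] by apply: imset_f.
  apply: (i_convex (mem_i a) (mem_i b)).
  by rewrite dab daz; move: zb; rewrite -(gdist_adj connG) => /eqP->; rewrite addn1.
subst z; have [p [pp lp sp]] := IH b' daz.
by exists (rcons p b); rewrite rcons_path pp lp -adj_i zb last_rcons size_rcons sp.
Qed.

Let connG' : connected G'.
Proof.
case/card_gt0P: T'_gt0 => r _; apply: (@connected_root _ _ r) => x.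
by have [p [pp lp _]] := lift_path r x; apply/connectP; exists p.
Qed.

Lemma subtree_gdist a b : gdist G' a b = gdist G (i a) (i b).
Proof.
apply/eqP; rewrite eqn_leq; apply/andP; split.
  by have [p [pp <- <-]] := lift_path a b; apply: gdist_le_path.
have [p [pp <- <-]] := gdist_path connG' a b.
rewrite -last_map -(size_map i); apply: gdist_le_path => //.
rewrite path_map; apply: sub_path pp => x y /=.
by rewrite adj_i.
Qed.

Lemma subtree_is_tree : is_tree G'.
Proof.
rewrite /is_tree connG'; case/card_gt0P: T'_gt0 => r _.
apply: (@acyclic_rank _ _ (fun a => gdist G (i r) (i a))) => x y y' xy xy' le le'.
by apply/i_inj/(closer_neighbor_inj treeG _ _ le le'); rewrite adj_i.
Qed.

End Subtree.

(** A path of [m] new vertices hung at [c]: a leg of a spider, or for [m = 1] a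
    new leaf. *)
Definition graft (A : finType) (e : rel A) (c : A) m : rel (A + 'I_m) :=
  fun x y => match x, y with
  | inl a, inl b => e a b
  | inl a, inr i | inr i, inl a => (a == c) && (i == 0 :> nat)
  | inr i, inr j => (i.+1 == j) || (j.+1 == i)
  end.

Lemma graft_sym (A : finType) (e : rel A) c m :
  symmetric e -> symmetric (graft e c (m := m)).
Proof. by move=> sym [a|i] [b|j] //=; rewrite orbC. Qed.

Lemma graft_irrefl (A : finType) (e : rel A) c m :
  irreflexive e -> irreflexive (graft e c (m := m)).
Proof. by move=> irr [a|i] //=; rewrite orbb; lia. Qed.

Lemma graft_iso (A B : finType) (e : rel A) (e' : rel B) c c' m f :
  rel_iso e e' f -> f c = c' ->
  exists2 g, rel_iso (graft e c (m := m)) (graft e' c' (m := m)) g &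
    g (inl c) = inl c'.
Proof.
move=> [fb ef] <-; have [f' fK f'K] := fb.
pose g (F : A -> B) (x : A + 'I_m) : B + 'I_m :=
  match x with inl a => inl (F a) | inr i => inr i end.
exists (g f) => //; split.
  by exists (fun x => match x with inl b => inl (f' b) | inr i => inr i end);
    case=> //= a; rewrite ?fK ?f'K.
by case=> [a|i] [b|j] //=; rewrite (inj_eq (bij_inj fb)).
Qed.

(** * The spider *)

Lemma gdist_potential (T : finType) (G : sgraph T) (g : T -> nat) x y :
  connected G -> (forall u v, adj G u v -> g v <= (g u).+1) ->
  g y <= g x + gdist G x y.
Proof.
move=> connG lip; have [p [pp <- <-]] := gdist_path connG x y.
elim: p x pp => [|z p IH] x /=; first by rewrite addn0.
move=> /andP[xz /IH le]; apply: leq_trans le _.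
by rewrite addnS -addSn leq_add2r lip.
Qed.

Section Spider.
Variables (s n : nat).
Local Notation q := s.+1.

(** The spider is a path on the vertices [0], ..., [s] together with legs of
    [s.+1] consecutive numbers each that are attached to [0]; the last leg may
    be shorter. *)
Definition spider_parent v := if v %% q == 0 then 0 else v.-1.

Definition spider_rel : rel 'I_n := fun u v =>
  (u != v) && ((u == spider_parent v :> nat) || (v == spider_parent u :> nat)).

Definition spider := rel_graph spider_rel.

Let level v := if v < q then v else (v %% q).+1.

Lemma adj_spider : adj spider =2 spider_rel.
Proof.
by apply: adj_rel_graph => [u v|u]; rewrite /spider_rel ?eqxx // eq_sym orbC.
Qed.

Let parent_le v : spider_parent v <= v.
Proof. by rewrite /spider_parent; case: ifP => // _; apply: leq_pred. Qed.

Let parent_block v : v %% q != 0 -> [/\ v.-1 %/ q = v %/ q,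
  (v.-1 %% q).+1 = v %% q & v.-1.+1 = v].
Proof.
move=> v0; have v_gt0 : 0 < v %% q by rewrite lt0n.
have lt_v : (v %% q).-1 < q by rewrite (leq_ltn_trans (leq_pred _)) ?ltn_pmod.
have -> : v.-1 = v %/ q * q + (v %% q).-1.
  by rewrite [in LHS](divn_eq v q) -{1}(prednK v_gt0) addnS.
rewrite divnMDl // modnMDl (divn_small lt_v) (modn_small lt_v) addn0 prednK //.
by split=> //; rewrite -addnS prednK // -divn_eq.
Qed.

Let parent_level v : 0 < v -> level v = (level (spider_parent v)).+1.
Proof.
move=> v_gt0; rewrite /spider_parent /level.
have [v0|v0] := eqVneq (v %% q) 0.
  rewrite v0 ltn0Sn; case: ltnP => // lt_v.
  by move: v0 v_gt0; rewrite modn_small // => ->.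
have [_ vq vv] := parent_block v0.
case: (ltnP v q) => lt_v; first by rewrite (leq_ltn_trans (leq_pred _) lt_v) vv.
case: (ltnP v.-1 q) => lt_v1; last by rewrite vq.
have qv : v = q by apply/eqP; rewrite eqn_leq lt_v andbT -vv ltnS; exact: lt_v1.
by move: v0; rewrite qv modnn.
Qed.

Lemma adj_spider_le u v : adj spider u v -> v <= u -> v = spider_parent u :> nat.
Proof.
rewrite adj_spider => /andP[uv /orP[]/eqP] // eu le_vu.
case/eqP: uv; apply/val_inj/eqP; rewrite /= eqn_leq le_vu eu parent_le.
by [].
Qed.

Hypothesis n_gt0 : 0 < n.
Let root : 'I_n := Ordinal n_gt0.

Let adj_parent (v : 'I_n) : 0 < v ->
  exists u : 'I_n, [/\ u = spider_parent v :> nat, u < v & adj spider u v].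
Proof.
move=> v_gt0; have lt_v : spider_parent v < v.
  by rewrite /spider_parent; case: ifP => // _; rewrite prednK.
exists (Ordinal (ltn_trans lt_v (ltn_ord v))); split=> //.
by rewrite adj_spider /spider_rel /= eqxx andbT neq_ltn /= lt_v.
Qed.

Let connected_spider : connected spider.
Proof.
apply: (@connected_root _ _ root) => v.
have [m] := ubnP (val v); elim: m v => // m IH v lt_v.
have [v0|v_gt0] := posnP (val v).
  by have -> : v = root; [apply: val_inj | apply: connect0].
have [u [_ lt_u uv]] := adj_parent v_gt0; apply: connect_trans (connect1 uv).
by apply: IH; apply: leq_trans lt_u lt_v.
Qed.

Lemma spider_is_tree : is_tree spider.
Proof.
rewrite /is_tree connected_spider; apply: (@acyclic_rank _ _ (@nat_of_ord n)).
move=> x y y' xy xy' le le'; apply: val_inj.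
by rewrite /= (adj_spider_le xy le) (adj_spider_le xy' le').
Qed.

Let d := gdist spider.

Let level_gdist v : d root v <= level v.
Proof.
have [m] := ubnP (val v); elim: m v => // m IH v lt_v.
have [v0|v_gt0] := posnP (val v).
  by have -> : v = root; [apply: val_inj | rewrite /d gdistxx].
have [u [uE lt_u uv]] := adj_parent v_gt0.
apply: leq_trans (gdist_triangle connected_spider u root v) _.
have -> : gdist spider u v = 1 by apply/eqP; rewrite gdist_adj.
rewrite addn1 (parent_level v_gt0) ltnS -uE.
by apply: IH; apply: leq_trans lt_u lt_v.
Qed.

(** The ends of the complete legs; vertex [s] ends the initial path, one step
    nearer to [0], and is not among them. *)
Let tips := [set v : 'I_n | (q <= v) && (v %% q == s)].

Let tip_far (r v : 'I_n) : r \in tips -> v %/ q != r %/ q ->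
  level v + s < d r v.
Proof.
rewrite inE => /andP[le_r /eqP rs] vr.
(* Up to the constant s.+1, this is the distance to 0, counted negatively on
   the leg of r. *)
pose g (u : 'I_n) := if u %/ q == r %/ q then s - u %% q else level u + q.
have r_gt0 : 0 < r %/ q by rewrite divn_gt0.
have g_parent (u w : 'I_n) : u != w -> u = spider_parent w :> nat ->
    g w <= (g u).+1 /\ g u <= (g w).+1.
  move=> uw uE; have w_gt0 : 0 < w.
    rewrite lt0n; apply: contra uw => /eqP w0; apply/eqP/val_inj.
    by rewrite /= uE w0 /spider_parent mod0n.
  have := parent_level w_gt0; rewrite -uE /g => lw.
  move: uE; rewrite /spider_parent; have [w0 u0|w0 uE] := eqVneq (w %% q) 0.
    rewrite u0 div0n (ltn_eqF r_gt0) w0 subn0 lw u0 /level /=.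
    by case: ifP; clear; lia.
  have [eqdiv modS _] := parent_block w0; rewrite uE eqdiv.
  have := ltn_pmod w (ltn0Sn s); rewrite -modS lw uE.
  by case: ifP; clear; lia.
have lip u w : adj spider u w -> g w <= (g u).+1.
  rewrite adj_spider => /andP[uw /orP[]/eqP e].
    by have [] := g_parent u w uw e.
  by have [] := g_parent w u _ e; rewrite 1?eq_sym.
have := gdist_potential r v connected_spider lip.
by rewrite /g eqxx rs subnn (negPf vr) add0n addnS.
Qed.

Let tip_mod (r r' : 'I_n) : r \in tips -> r' \in tips -> r %/ q = r' %/ q -> r = r'.
Proof.
rewrite !inE => /andP[_ /eqP rs] /andP[_ /eqP rs'] e; apply: val_inj => /=.
by rewrite (divn_eq r q) (divn_eq r' q) e rs rs'.
Qed.

(** The vertices that are not tips are pairwise near and the tips pairwise far,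
    so a maximal independent set is determined by its only vertex that is not
    a tip. There is one, because vertex [s] is far from all tips. *)
Lemma spider_mdis : q <= n -> #|mdis spider s.*2| + n %/ q <= n.+1.
Proof.
move=> le_qn; have conn := connected_spider.
have tip_tip r r' : r \in tips -> r' \in tips -> d r r' <= s.*2 -> r = r'.
  move=> rT r'T le_d; apply: tip_mod => //; apply/eqP; rewrite eq_sym.
  apply: contraTT le_d => ne; rewrite -ltnNge.
  apply: leq_ltn_trans (tip_far rT ne); rewrite -addnn leq_add2r.
  move: r'T; rewrite inE /level => /andP[le_q /eqP->].
  by rewrite ltnNge le_q.
have ball u v : u \notin tips -> v \notin tips -> d u v <= s.*2.
  have le_s w : w \notin tips -> d root w <= s.
    rewrite inE => wT; apply: leq_trans (level_gdist w) _; move: wT.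
    rewrite /level leqNgt; case: ltnP => //= _; have := ltn_pmod w (ltn0Sn s).
    by clear; lia.
  move=> /le_s du /le_s dv; apply: leq_trans (gdist_triangle conn root u v) _.
  by rewrite -addnn leq_add // gdistC.
pose top : 'I_n := Ordinal le_qn.
have topT : top \notin tips by rewrite inE /= ltnn.
have top_far r : r \in tips -> s.*2 < d r top.
  move=> rT; have := rT; rewrite inE => /andP[le_r _].
  have := @tip_far r top rT; rewrite /= divn_small // /level ltnSn addnn; apply.
  by rewrite eq_sym -lt0n divn_gt0.
have inj : {in mdis spider s.*2 &, injective (fun J => J :\: tips)}.
  suff sub J J' : J \in mdis spider s.*2 -> J' \in mdis spider s.*2 ->
      J :\: tips = J' :\: tips -> J \subset J'.
    by move=> J J' mJ mJ' e; apply/eqP; rewrite eqEsubset !sub.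
  move=> /(mdisP _ conn)[_ indJ _] /(mdisP _ conn)[_ _ domJ'] e.
  apply/subsetP => x xJ; have [xT|xT] := boolP (x \in tips); last first.
    have: x \in J' :\: tips by rewrite -e in_setD xT.
    by case/setDP.
  have [y yJ' le_d] := domJ' x (in_setT x).
  have [yT|yT] := boolP (y \in tips); first by rewrite (tip_tip x y).
  have /setDP[yJ _] : y \in J :\: tips by rewrite e in_setD yT.
  by rewrite (indJ x y).
have to_set1 J : J \in mdis spider s.*2 ->
    J :\: tips \in [set [set u] | u in ~: tips].
  move=> /(mdisP _ conn)[_ indJ domJ].
  have [u uJ uT] : exists2 u, u \in J & u \notin tips.
    have [y yJ le_d] := domJ top (in_setT _); exists y => //.
    apply/negP => yT; have := top_far y yT.
    by rewrite ltnNge /d gdistC // le_d.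
  apply/imsetP; exists u; first by rewrite in_setC.
  apply/setP => v; rewrite in_setD in_set1; apply/andP/eqP => [[vT vJ]|->] //.
  by apply: indJ => //; apply: ball.
have le_M : #|mdis spider s.*2| <= #|~: tips|.
  rewrite -(card_in_imset inj) -(card_imset (mem (~: tips)) set1_inj).
  by apply: subset_leq_card; apply/subsetP => _ /imsetP[J mJ ->]; apply: to_set1.
have tips_ge : n %/ q <= #|tips|.+1.
  have lt_tip (t : 'I_(n %/ q).-1) : t.+1 * q + s < n.
    have lt_t : t.+1 < n %/ q by have := ltn_ord t; clear; lia.
    rewrite -addnS -mulSnr; apply: leq_trans (leq_trunc_div n q).
    by rewrite leq_mul2r lt_t orbT.
  pose h t : 'I_n := Ordinal (lt_tip t).
  have h_inj : injective h.
    move=> t t' /(congr1 val) /= /eqP; rewrite eqn_add2r eqn_pmul2r // eqSS.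
    by move/eqP/val_inj.
  rewrite -[n %/ q]prednK ?divn_gt0 // ltnS -[X in X <= _]card_ord.
  rewrite -(card_codom h_inj); apply: subset_leq_card; apply/subsetP => _ /codomP[t ->].
  by rewrite inE /= modnMDl modn_small // eqxx andbT mulSn -addnA leq_addr.
have := cardsC tips; rewrite card_ord; move: le_M tips_ge.
by move: #|tips| #|~: tips| (n %/ q) => a b f; clear; lia.
Qed.

End Spider.

(** * Stripping a leg *)

Definition pointed_iso (A B : finType) (e : rel A) a (e' : rel B) b :=
  exists2 f, rel_iso e e' f & f a = b.

Definition grafted (T T' : finType) m (G : sgraph T) c (G' : sgraph T') c' :=
  pointed_iso (graft (adj G') c' (m := m)) (inl c') (adj G) c.

Lemma pointed_iso_inv (A B : finType) (e : rel A) a (e' : rel B) b :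
  pointed_iso e a e' b -> pointed_iso e' b e a.
Proof. by case=> f /rel_iso_inv[g gi [fK _]] <-; exists g. Qed.

Lemma pointed_iso_comp (A B C : finType) (e : rel A) a (e' : rel B) b
    (e'' : rel C) c :
  pointed_iso e a e' b -> pointed_iso e' b e'' c -> pointed_iso e a e'' c.
Proof.
case=> f fi <- [g gi <-]; exists (g \o f) => //; exact: rel_iso_comp fi gi.
Qed.

(** Legs are interchangeable, so it is enough to match what remains with the
    centres fixed. *)
Lemma grafted_iso (T1 T2 T1' T2' : finType) m (G : sgraph T1) c
    (G' : sgraph T1') c' (H : sgraph T2) b (H' : sgraph T2') b' :
  grafted m G c G' c' -> grafted m H b H' b' ->
  pointed_iso (adj G') c' (adj H') b' -> pointed_iso (adj G) c (adj H) b.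
Proof.
move=> gG gH [f fi fc]; apply: pointed_iso_comp (pointed_iso_inv gG) _.
apply: pointed_iso_comp gH; have [g gi gc] := graft_iso m fi fc.
by exists g.
Qed.

Lemma rel_iso_gdist (T T' : finType) (G : sgraph T) (H : sgraph T') f :
  is_tree H -> rel_iso (adj G) (adj H) f ->
  forall x y, gdist H (f x) (f y) = gdist G x y.
Proof.
move=> treeH [fb ef] x y; symmetry.
apply: (subtree_gdist treeH (bij_inj fb) ef); last by apply/card_gt0P; exists x.
move=> a b z _ _ _; have [g _ gK] := fb.
by apply/imsetP; exists (g z); rewrite ?gK.
Qed.

Section StripLeg.
Variables (T : finType) (G : sgraph T) (s n' : nat) (c x : T).
Hypotheses (treeG : is_tree G) (s_gt0 : 0 < s) (centre_c : centre G s c).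
Hypotheses (xc : adj G x c) (tip_x : beyond G s x c != set0).
Hypotheses (leg_x : #|side G x c| = s.+1) (cardT : #|T| = n' + s.+1).
Local Notation d := (gdist G).

Let connG : connected G. Proof. by case/andP: treeG. Qed.
Let cx : adj G c x. Proof. by rewrite adj_sym. Qed.
Let U := side G c x.

Let memU v : (v \in U) = (v \notin side G x c).
Proof.
by apply/idP/idP; [apply: side_disjoint | apply: side_cover].
Qed.

Let cardU : #|U| = n'.
Proof.
have -> : U = ~: side G x c by apply/setP => v; rewrite memU in_setC.
by apply/eqP; rewrite cardsCs setCK cardT leg_x addnK.
Qed.

Let keep (a : 'I_n') : T := enum_val (cast_ord (esym cardU) a).

Let keep_mem a : keep a \in U. Proof. exact: enum_valP. Qed.

Let keep_inj : injective keep.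
Proof. by move=> a b /enum_val_inj/cast_ord_inj. Qed.

Let keep_onto v : v \in U -> exists a, v = keep a.
Proof.
move=> vU; exists (cast_ord cardU (enum_rank_in vU v)).
by rewrite /keep cast_ordK enum_rankK_in.
Qed.

Let leg (j : 'I_s.+1) : T := odflt x [pick v in side G x c | d x v == j].

Let legP j : leg j \in side G x c /\ d x (leg j) = j.
Proof.
have /set0Pn[r] := tip_x; rewrite beyondE // => /andP[rx le_s].
have le_j : j <= d x r by rewrite gdistC // (leq_trans _ le_s) // -ltnS.
have [v xv vr] := gdist_between connG le_j.
have vx : v \in side G x c.
  by apply: (side_convex treeG xc (side_self treeG xc) rx); rewrite xv.
rewrite /leg; case: pickP => [w /andP[wx /eqP]|/(_ v)] //=.
by rewrite vx xv eqxx.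
Qed.

Let leg_inj : injective leg.
Proof.
by move=> i j e; apply: val_inj; rewrite /= -(legP i).2 e (legP j).2.
Qed.

Let leg_onto v : v \in side G x c -> exists j, v = leg j.
Proof.
suff -> : side G x c = [set leg j | j in 'I_s.+1].
  by case/imsetP=> j _ ->; exists j.
apply/esym/eqP; rewrite eqEcard leg_x card_imset // card_ord leqnn andbT.
by apply/subsetP => _ /imsetP[j _ ->]; have [] := legP j.
Qed.

Let adj_leg i j : adj G (leg i) (leg j) = (i.+1 == j) || (j.+1 == i).
Proof.
have [ix di] := legP i; have [jx dj] := legP j.
have succ (a b : 'I_s.+1) : a.+1 = b -> adj G (leg a) (leg b).
  move=> ab; have [ax da] := legP a; have [bx db] := legP b.
  have [|z zb dz] := @gdist_step _ _ connG x (leg b) a; first by rewrite db.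
  have zx : z \in side G x c.
    apply: (side_convex treeG xc (side_self treeG xc) bx).
    by rewrite dz db -ab; move: zb; rewrite -gdist_adj // => /eqP->; rewrite addn1.
  have [a' za'] := leg_onto zx; have [_ da'] := legP a'.
  have -> // : leg a = z.
  by rewrite za'; congr leg; apply: val_inj; rewrite /= -dz za' da'.
apply/idP/orP => [ij|[/eqP/succ//|/eqP/succ]]; last by rewrite adj_sym.
have := adj_gdist_neq treeG x ij; have := gdist_triangle connG (leg i) x (leg j).
have := gdist_triangle connG (leg j) x (leg i); rewrite (gdistC connG (leg j)).
move: ij; rewrite -(gdist_adj connG) => /eqP ->; rewrite di dj; clear; lia.
Qed.

Let adj_leg_keep j v : v \in U -> adj G (leg j) v = (v == c) && (j == 0 :> nat).
Proof.
move=> vU; have [jx dj] := legP j.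
rewrite -(gdist_adj connG) (gdist_across treeG xc jx vU) gdistC // dj.
by rewrite -(gdist_eq0 connG) (gdistC connG c); clear; lia.
Qed.

Let c_keep : exists c', keep c' = c.
Proof. by have [a ->] := keep_onto (side_self treeG cx); exists a. Qed.

Let G' := rel_graph (fun a b => adj G (keep a) (keep b)).

Let adj_keep a b : adj G (keep a) (keep b) = adj G' a b.
Proof.
by rewrite adj_rel_graph // => [u v|u]; [apply: adj_sym | apply: adj_irrefl].
Qed.

Let keep_image : [set keep a | a in 'I_n'] = U.
Proof.
apply/setP => v; apply/imsetP/idP => [[a _ ->]|/keep_onto[a ->]] //.
by exists a.
Qed.

Let n'_gt0 : 0 < #|'I_n'|.
Proof. by have [c' _] := c_keep; apply/card_gt0P; exists c'. Qed.

Let convex_keep : convex G [set keep a | a in 'I_n'].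
Proof. by rewrite keep_image; apply: side_convex. Qed.

Let gdist_keep a b : gdist G' a b = d (keep a) (keep b).
Proof. exact: (subtree_gdist treeG keep_inj adj_keep convex_keep n'_gt0). Qed.

Let treeG' : is_tree G'.
Proof. exact: (subtree_is_tree treeG keep_inj adj_keep convex_keep n'_gt0). Qed.

Let grafted_keep c' : keep c' = c -> grafted s.+1 G c G' c'.
Proof.
move=> kc; exists (fun y => match y with inl a => keep a | inr j => leg j end) => //.
have leg_keep j a : leg j <> keep a.
  move=> e; have := keep_mem a; rewrite -e memU.
  by have [-> _] := legP j.
split.
  apply: inj_card_bij; last by rewrite card_sum !card_ord cardT.
  case=> [a|j] [b|l] //= e; [by rewrite (keep_inj e)| | |by rewrite (leg_inj e)].
    by have := leg_keep l a; rewrite e.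
  by have := leg_keep j b; rewrite e.
have ckeep a : (keep a == c) = (a == c') by rewrite -kc (inj_eq keep_inj).
case=> [a|j] [b|l] /=.
- exact: adj_keep.
- by rewrite adj_sym adj_leg_keep // ckeep.
- by rewrite adj_leg_keep // ckeep.
- exact: adj_leg.
Qed.

Let mem_rim c' a : keep c' = c -> (a \in rim G' s c') = (keep a \in rim G s c).
Proof. by move=> kc; rewrite !inE gdist_keep kc. Qed.

Let centre_keep c' : keep c' = c -> centre G' s c'.
Proof.
move=> kc y yc'; rewrite -(card_imset _ keep_inj).
apply: leq_trans (centre_c (_ : adj G (keep y) c)); last first.
  by rewrite -kc adj_keep.
apply: subset_leq_card; apply/subsetP => _ /imsetP[a aB ->].
by move: aB; rewrite !inE !gdist_keep kc.
Qed.

Let card_rim_keep c' : keep c' = c -> #|rim G s c| = #|rim G' s c'|.+1.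
Proof.
move=> kc; rewrite -(cardsID (side G x c)) -beyond_rim.
have -> : #|beyond G s x c| = 1.
  by apply/eqP; rewrite eqn_leq card_gt0 tip_x centre_c.
rewrite add1n -(card_imset _ keep_inj); congr _.+1; apply: eq_card => v.
rewrite in_setD -memU; apply/andP/imsetP => [[/keep_onto[a ->] vR]|[a aR ->]].
  by exists a; rewrite ?mem_rim.
by rewrite keep_mem -(mem_rim a kc).
Qed.

Let open_rim_keep c' : keep c' = c -> open_rim G s c -> open_rim G' s c'.
Proof.
move=> kc /existsP[u /andP[/eqP duc /forall_inP far]].
have [ux|] := boolP (u \in side G x c).
  have /set0Pn[r rB] := tip_x; have := rB; rewrite inE => /andP[rx lt_r].
  have rR : r \in rim G s c by rewrite inE.
  have := far r rR; have := gdist_branch treeG xc ux rx.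
  by rewrite duc (rim_gdist treeG centre_c rR); clear; lia.
rewrite -memU => /keep_onto[a ua]; apply/existsP; exists a.
rewrite gdist_keep kc -ua duc eqxx; apply/forall_inP => r.
by rewrite (mem_rim r kc) gdist_keep -ua; apply: far.
Qed.

(** A branch that reaches the rim and has only [s.+1] vertices is a path, so the
    tree is obtained from the rest by grafting. The other branches do not
    notice its removal. *)
Lemma strip_leg : exists (G1 : sgraph 'I_n') c1,
  [/\ is_tree G1, centre G1 s c1, grafted s.+1 G c G1 c1,
      #|rim G s c| = #|rim G1 s c1|.+1 & open_rim G s c -> open_rim G1 s c1].
Proof.
have [c' kc] := c_keep; exists G', c'; split=> //.
- exact: centre_keep.
- exact: grafted_keep.
- exact: card_rim_keep.
- exact: open_rim_keep.
Qed.

End StripLeg.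

(** * Embedding isomorphism classes *)

(** Up to isomorphism, the graphs with property [P] inject into those with
    property [Q]. A relation instead of a function leaves open which centre or
    leg a construction uses. *)
Definition embeds n m (P : sgraph 'I_n -> Prop) (Q : sgraph 'I_m -> Prop) :=
  exists R : sgraph 'I_n -> sgraph 'I_m -> Prop,
    (forall G, P G -> exists2 G', R G G' & Q G') /\
    forall G H G' H', R G G' -> R H H' -> isomorphic G' H' -> isomorphic G H.

Lemma embeds_refl n P : @embeds n n P P.
Proof.
exists (fun G G' => G' = G); split=> [G PG|G H _ _ -> ->] //.
by exists G.
Qed.

Lemma embeds_trans n m p P Q S :
  @embeds n m P Q -> @embeds m p Q S -> embeds P S.
Proof.
move=> [R [Rex Riso]] [R' [R'ex R'iso]].
exists (fun G G'' => exists2 G', R G G' & R' G' G''); split=> [G /Rex[G' RG /R'ex]|].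
  by case=> G'' R'G SG; exists G'' => //; exists G'.
move=> G H G'' H'' [G' GG' G'G''] [H' HH' H'H''] /(R'iso _ _ _ _ G'G'' H'H'').
exact: Riso.
Qed.

Lemma embeds_sub n m P P' Q :
  (forall G, P' G -> P G) -> @embeds n m P Q -> embeds P' Q.
Proof. by move=> sub [R [Rex Riso]]; exists R; split=> // G /sub/Rex. Qed.

Lemma finite_choice (A : finType) (B : Type) (R : A -> B -> Prop) (D : {set A}) :
  (forall a, a \in D -> exists b, R a b) -> D != set0 ->
  exists f, forall a, a \in D -> R a (f a).
Proof.
move=> ex /set0Pn[a0 /ex[b0 _]].
suff choice (l : seq A) : {subset l <= D} ->
    exists f, forall a, a \in l -> R a (f a).
  have [|f hf] := choice (enum D); first by move=> a; rewrite mem_enum.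
  by exists f => a aD; apply: hf; rewrite mem_enum.
elim: l => [|a l IH] sub; first by exists (fun=> b0).
have [|f hf] := IH; first by move=> x xl; apply: sub; rewrite inE xl orbT.
have [|b Rb] := ex a; first by apply: sub; rewrite mem_head.
exists (fun x => if x == a then b else f x) => x; rewrite inE.
by case: eqP => [->|_ /hf].
Qed.

Lemma embeds_card n m (P : sgraph 'I_n -> Prop) (trees : {set sgraph 'I_n}) :
  embeds P (fun G : sgraph 'I_m => is_tree G) ->
  (forall G, G \in trees -> P G) ->
  (forall G H, G \in trees -> H \in trees -> G != H -> ~~ isomorphic G H) ->
  #|trees| <= num_trees m.
Proof.
move=> [R [Rex Riso]] treesP noniso.
have [->|trees0] := eqVneq trees set0; first by rewrite cards0.
have [G /treesP/Rex[G' RG tG]|f hf] :=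
  @finite_choice _ _ (fun G G' => R G G' /\ is_tree G') trees _ trees0.
  by exists G'.
pose D := [set G : sgraph 'I_m | is_tree G].
have equiv : {in D & &, equivalence_rel (@isomorphic 'I_m)}.
  by move=> G H K _ _ _; apply: isomorphic_equiv.
have fD G : G \in trees -> f G \in D by move=> /hf[]; rewrite inE.
pose part := equivalence_partition (@isomorphic 'I_m) D.
have /and3P[/eqP coverD _ _] := equivalence_partitionP equiv.
have inj : {in trees &, injective (fun G => pblock part (f G))}.
  move=> G H Gt Ht e; apply/eqP/negPn/negP => GH.
  case/negP: (noniso G H Gt Ht GH).
  have [RG _] := hf G Gt; have [RH _] := hf H Ht; apply: Riso RG RH _.
  rewrite -(pblock_equivalence_partition equiv) ?fD // e.
  by rewrite mem_pblock coverD fD.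
rewrite -(card_in_imset inj); apply: subset_leq_card; apply/subsetP => B.
by case/imsetP=> G Gt ->; apply: pblock_mem; rewrite coverD fD.
Qed.

Section Centre.
Variables (T : finType) (G : sgraph T) (s : nat) (c : T).
Hypotheses (treeG : is_tree G) (centre_c : centre G s c).

Let connG : connected G. Proof. by case/andP: treeG. Qed.

(** From a vertex other than [c], the way to a rim vertex in another branch
    leads through [c]; among two rim vertices one is in another branch. *)
Lemma centre_eccentricity v : 1 < #|rim G s c| ->
  (forall w, gdist G v w <= s.+1) <-> v = c.
Proof.
move=> /card_gt1P[r1 [r2 [r1R r2R r12]]]; split=> [ecc|-> w]; last first.
  have [wR|] := boolP (w \in rim G s c).
    by rewrite gdistC // (rim_gdist treeG centre_c).
  by rewrite inE -leqNgt gdistC // => le_s; apply: leqW.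
apply/eqP/negPn/negP => vc; have [x xc vx] := branch_exists treeG vc.
suff [r rR rx] : exists2 r, r \in rim G s c & r \notin side G x c.
  have := ecc r; rewrite (gdist_branches treeG xc vx rx).
  rewrite (rim_gdist treeG centre_c rR) -[X in _ <= X]add0n leq_add2r leqn0.
  by rewrite gdist_eq0 // (negPf vc).
have [r1x|] := boolP (r1 \in side G x c); last by exists r1.
exists r2 => //; apply: contra r12 => r2x; apply/eqP.
exact: (rim_inj centre_c xc).
Qed.

(** Otherwise every branch that reaches the rim has at least [s.+2] vertices,
    which is more than there is room for. *)
Lemma exists_pure_leg : 0 < s ->
  #|T| < (#|rim G s c| * s.+2 + open_rim G s c * s).+1 ->
  exists x, [/\ adj G x c, beyond G s x c != set0 & #|side G x c| = s.+1].
Proof.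
move=> s_gt0 few.
have [/existsP[x /and3P[xc x0 /eqP xs]]|/existsPn none] :=
  boolP [exists x, [&& adj G x c, beyond G s x c != set0 & #|side G x c| == s.+1]].
  by exists x.
have := @centre_card _ _ _ _ treeG s_gt0 centre_c s.+2; rewrite leqNgt few.
have big x : adj G x c -> beyond G s x c != set0 -> s.+2 <= #|side G x c|.
  move=> xc x0; have := none x; rewrite xc x0 /= ltn_neqAle eq_sym => ->.
  exact: branch_card.
by move/(_ big).
Qed.

End Centre.

(** If this failed, the third and fourth hypotheses would give [r <= s] and so
    [n <= s ^ 2 + 3 * s + 1], which is at most [4 * s ^ 2] for [s >= 2]. *)
Lemma leg_count s f r n (b : bool) : 1 < s -> s.*2 ^ 2 < n ->
  n < f.+1 * s.+1 -> f + ~~ b <= r.+1 -> n < (r * s.+2 + b * s).+1.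
Proof. by rewrite -mul2n expnMn; case: b => /=; nia. Qed.

(** The order is large enough for some branch that reaches the rim to be a bare
    path and for two rim vertices to remain after its deletion, by which any
    isomorphism recognizes the centre. *)
Lemma embeds_strip s n : 1 < s -> s.*2 ^ 2 < n + s.+1 ->
  @embeds (n + s.+1) n (fun G => exists c, near_spider s G c)
                       (fun G => exists c, near_spider s G c).
Proof.
move=> s_gt1 big; have s_gt0 : 0 < s by apply: ltnW.
exists (fun G G' => exists c c', [/\ is_tree G', centre G' s c',
  1 < #|rim G' s c'| & grafted s.+1 G c G' c']); split; last first.
  move=> G H G' H' [c [c' [tG cG rG gG]]] [b [b' [tH cH rH gH]]].
  move=> /isomorphicP[f fi]; apply/isomorphicP.
  have fc : f c' = b'.
    apply/(centre_eccentricity tH cH (f c') rH) => w.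
    have [g _ [_ gK]] := rel_iso_inv fi; rewrite -(gK w) (rel_iso_gdist tH fi).
    by have [_ ->] := centre_eccentricity tG cG c' rG.
  have [|g gi _] := grafted_iso gG gH; first by exists f.
  by exists g.
move=> G [c [tG cG]]; rewrite card_ord => rimG.
have ge4 : 4 <= (n + s.+1) %/ s.+1.
  rewrite leq_divRL //; apply: leq_trans big; move: s_gt1; clear.
  by rewrite -mul2n expnMn; nia.
have [|x [xc x0 xs]] := exists_pure_leg tG cG s_gt0.
  rewrite card_ord; apply: leg_count s_gt1 big _ rimG.
  exact: ltn_ceil.
have [|G' [c' [tG' cG' gG' rimE openE]]] := strip_leg tG cG xc x0 xs (n' := n).
  by rewrite card_ord.
exists G'.
  exists c, c'; split=> //; move: rimG ge4; rewrite rimE.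
  by move: (_ %/ _) #|rim G' s c'| => f r; clear; lia.
exists c'; split=> //; rewrite card_ord.
have : ~~ open_rim G' s c' <= ~~ open_rim G s c.
  by case: (open_rim G s c) openE => [/(_ isT)->|_] //; rewrite leq_b1.
have divE : (n + s.+1) %/ s.+1 = (n %/ s.+1).+1.
  by rewrite addnC -{1}[s.+1]mul1n divnMDl.
move: rimG; rewrite rimE divE.
move: (_ %/ _) #|rim G' s c'| (open_rim G s c) (open_rim G' s c') => f r a b.
clear; case: a b => -[] /=; lia.
Qed.

(** * Adding a leaf *)

Definition degree (T : finType) (e : rel T) u := #|[set x | e u x]|.

Definition leaf_degree (T : finType) (e : rel T) v :=
  #|[set u | e v u && (degree e u == 1)]|.

Lemma rel_iso_degree (A B : finType) (e : rel A) (e' : rel B) f u :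
  rel_iso e e' f -> degree e' (f u) = degree e u.
Proof.
move=> [fb ef]; rewrite /degree -(card_imset _ (bij_inj fb)).
have [g _ gK] := fb; apply: eq_card => y; rewrite inE.
apply/idP/imsetP => [uy|[x]]; last by rewrite inE => ux ->; rewrite ef.
by exists (g y); rewrite ?inE -?(ef u) gK.
Qed.

Lemma rel_iso_leaf_degree (A B : finType) (e : rel A) (e' : rel B) f u :
  rel_iso e e' f -> leaf_degree e' (f u) = leaf_degree e u.
Proof.
move=> fi; have [fb ef] := fi; rewrite /leaf_degree -(card_imset _ (bij_inj fb)).
have [g _ gK] := fb; apply: eq_card => y; rewrite inE.
apply/idP/imsetP => [uy|[x]]; last first.
  by rewrite inE => ux ->; rewrite ef (rel_iso_degree _ fi).
by exists (g y); rewrite ?inE -?(ef u) -?(rel_iso_degree _ fi) gK.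
Qed.

(** If the new leaf is mapped to an old vertex [z], then [z] and the new leaf on
    the other side are leaves at the same vertex and can be exchanged. *)
Lemma graft_leaf_cancel (A B : finType) (e : rel A) (e' : rel B) v w F :
  #|A| = #|B| -> symmetric e' ->
  rel_iso (graft e v (m := 1)) (graft e' w (m := 1)) F -> F (inl v) = inl w ->
  exists f, rel_iso e e' f.
Proof.
move=> cardAB sym [Fb eF] Fv; have Finj := bij_inj Fb.
pose new (C : Type) : C + 'I_1 := inr ord0.
have newP C i : inr i = new C by congr inr; apply: val_inj; case: i => [[]].
have gsym := @graft_sym _ _ w 1 sym.
pose z := F (new A); pose t y := if y == new B then z else y.
have z_nbr y : graft e' w z y = (y == inl w).
  have [F' _ F'K] := Fb; rewrite -(F'K y) eF -Fv (inj_eq Finj).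
  case: (F' y) => [a|i] /=; first by rewrite andbT.
  by case: i => [[]].
have new_nbr y : graft e' w (new B) y = (y == inl w).
  by case: y => [b|[[] //]]; rewrite /= ?andbT.
have t_iso y y' : graft e' w (t y) (t y') = graft e' w y y'.
  have tl u u' : graft e' w (t u) u' = graft e' w u u'.
    by rewrite /t; case: eqP => [->|//]; rewrite z_nbr new_nbr.
  by rewrite tl gsym tl gsym.
have z_new a : F (inl a) == new B -> z != new B.
  by move=> /eqP e1; apply/eqP; rewrite -e1 => /Finj.
have t_inj a a' : t (F (inl a)) = t (F (inl a')) -> inl a = inl a' :> A + 'I_1.
  rewrite /t; case: eqP => [e1|_]; case: eqP => [e2|_].
  - by move=> _; apply: Finj; rewrite e1 e2.
  - by move/Finj.
  - by move/esym/Finj.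
  - by move/Finj.
pose out (y : B + 'I_1) := if y is inl b then b else w.
have outK a : inl (out (t (F (inl a)))) = t (F (inl a)).
  have : t (F (inl a)) != new B.
    by rewrite /t; case: ifP => [/z_new|/negbT].
  by case: (t _) => //= i; rewrite newP eqxx.
exists (fun a => out (t (F (inl a)))); split=> [|a a'].
  apply: inj_card_bij; last by rewrite cardAB.
  by move=> a a' e1; apply: (@inl_inj A 'I_1); apply: t_inj; rewrite -[LHS]outK -[RHS]outK; congr inl.
have := t_iso (F (inl a)) (F (inl a')); rewrite -(outK a) -(outK a') /= => ->.
by rewrite eF.
Qed.

Section AddLeaf.
Variables (n : nat) (G : sgraph 'I_n).
Hypotheses (treeG : is_tree G) (n_gt1 : 1 < n).

Let connG : connected G. Proof. by case/andP: treeG. Qed.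

Let degree_gt0 v : 0 < degree (adj G) v.
Proof.
have [u uv] : exists u, u != v.
  have /card_gt1P[a [b [_ _ ab]]] : 1 < #|'I_n| by rewrite card_ord.
  by have [<-|] := eqVneq a v; [exists b; rewrite eq_sym | exists a].
have [x xv _] := branch_exists treeG uv.
by rewrite card_gt0; apply/set0Pn; exists x; rewrite inE adj_sym.
Qed.

Variable v : 'I_n.
Hypothesis v_max : forall u, leaf_degree (adj G) u <= leaf_degree (adj G) v.
Let gr := graft (adj G) v (m := 1).

Let degree_old u : u != v -> degree gr (inl u) = degree (adj G) u.
Proof.
move=> uv; rewrite /degree -[RHS](card_imset _ (@inl_inj _ 'I_1)).
apply: eq_card => y; rewrite inE; apply/idP/imsetP => [|[x]].
  by case: y => [a ua|i] /=; [exists a; rewrite ?inE | rewrite (negPf uv)].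
by rewrite inE => ux ->.
Qed.

Let degree_v : 1 < degree gr (inl v).
Proof.
have /card_gt0P[x] := degree_gt0 v; rewrite inE => vx.
apply/card_gt1P; exists (inl x), (inr ord0); split; rewrite ?inE //=.
by rewrite eqxx.
Qed.

(* Any vertex other than v keeps its leaves, and v gains one. *)
Let new_leaf_degree u : u != inl v -> leaf_degree gr u < leaf_degree gr (inl v).
Proof.
have v_gt : leaf_degree (adj G) v < leaf_degree gr (inl v).
  rewrite /leaf_degree -(card_imset _ (@inl_inj _ 'I_1)).
  apply: proper_card; apply/properP; split.
    apply/subsetP => _ /imsetP[x + ->]; rewrite !inE => /andP[vx].
    rewrite degree_old //=; first by rewrite vx.
    by apply: contraTneq vx => ->; rewrite adj_irrefl.
  exists (inr ord0); last by apply/imsetP => -[].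
  rewrite inE /= eqxx /=; apply/cards1P; exists (inl v); apply/setP => y.
  by rewrite !inE; case: y => [a|[[] //]]; rewrite /= ?andbT.
case: u => [u uv|i _]; last first.
  suff -> : leaf_degree gr (inr i) = 0 by apply: leq_ltn_trans v_gt.
  apply/eqP; rewrite cards_eq0; apply/eqP/setP => y.
  rewrite !inE; apply/negP => /andP[]; case: y => [a|j] /=; last first.
    by move: (ltn_ord i) (ltn_ord j); lia.
  by case: eqP => // -> _ /eqP e; move: degree_v; rewrite e.
have uv' : u != v by apply: contraNneq uv => ->.
apply: leq_ltn_trans v_gt; apply: leq_trans (v_max u).
rewrite /leaf_degree -[X in _ <= X](card_imset _ (@inl_inj _ 'I_1)).
apply: subset_leq_card; apply/subsetP => y; rewrite inE => /andP[uy dy].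
case: y uy dy => [a ua da|j] /=; last by rewrite (negPf uv').
apply/imset_f; rewrite inE (ua : adj G u a) /=; have [av|av] := eqVneq a v.
  by move: degree_v; rewrite -av (eqP da).
by rewrite -degree_old.
Qed.

Let G' : sgraph 'I_(n + 1) := rel_graph (fun i j => gr (split i) (split j)).

Let adj_G' i j : adj G' i j = gr (split i) (split j).
Proof.
rewrite adj_rel_graph // => [a b|a].
  exact: graft_sym (@adj_sym _ G) _ _.
exact: graft_irrefl (@adj_irrefl _ G) _.
Qed.

Let unsplit_iso : rel_iso gr (adj G') (@unsplit n 1).
Proof.
split=> [|x y]; last by rewrite adj_G' !unsplitK.
by exists (@split n 1); [apply: unsplitK | apply: splitK].
Qed.

Let tree_G' : is_tree G'.
Proof.
have [_ adj_unsplit] := unsplit_iso.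
have conn : connected G'.
  apply: (@connected_root _ _ (unsplit (inl v))) => i; rewrite -(splitK i).
  pose old a : 'I_(n + 1) := unsplit (inl a).
  have old_conn u : connect (adj G') (old v) (old u).
    have /connectP[p pp ->] := connected_connect connG v u.
    apply/connectP; exists (map old p); last by rewrite last_map.
    by rewrite path_map; apply: sub_path pp => a b /=; rewrite adj_unsplit.
  case: (split i) => [u|j]; first exact: old_conn.
  apply: connect1; rewrite adj_unsplit /= eqxx /=.
  by move: (ltn_ord j); lia.
rewrite /is_tree conn.
pose rank (i : 'I_(n + 1)) := match split i with inl a => gdist G v a | inr _ => n end.
have lt_n a : gdist G v a < n.
  rewrite -[X in _ < X]card_ord -cardsT.
  by apply: convex_card; rewrite ?inE // => x y z; rewrite !inE.
apply: (@acyclic_rank _ _ rank) => i j l; rewrite !adj_G' /rank.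
rewrite -{3}(splitK j) -{3}(splitK l).
case: (split i) => [a|x]; case: (split j) => [b|y]; case: (split l) => [b'|y'] //=.
- by move=> ab ab' le le'; rewrite (closer_neighbor_inj treeG ab ab' le le').
- by move=> _ _ _; rewrite leqNgt lt_n.
- by move=> _ _; rewrite leqNgt lt_n.
- by move=> _ _; rewrite leqNgt lt_n.
- by move=> /andP[/eqP-> _] /andP[/eqP-> _].
- by move=> _; move: (ltn_ord x) (ltn_ord y'); lia.
- by move: (ltn_ord x) (ltn_ord y); lia.
- by move: (ltn_ord x) (ltn_ord y); lia.
Qed.

Lemma add_leaf : exists G1 : sgraph 'I_(n + 1), is_tree G1 /\
  exists w, [/\ exists f, rel_iso (graft (adj G) w (m := 1)) (adj G1) f &
    forall u, u != inl w ->
      leaf_degree (graft (adj G) w (m := 1)) u <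
      leaf_degree (graft (adj G) w (m := 1)) (inl w)].
Proof.
exists G'; split=> //; exists v; split=> //.
by exists (@unsplit n 1).
Qed.

End AddLeaf.

(** The new leaf goes to a vertex that already has the most leaves. It is then
    the only one with the most leaves, and all its leaves are alike, so deleting
    any of them recovers the original tree. *)
Lemma embeds_add_leaf n : 1 < n ->
  @embeds n (n + 1) (fun G => is_tree G) (fun G => is_tree G).
Proof.
move=> n_gt1.
exists (fun G G' => exists w,
  [/\ exists f, rel_iso (graft (adj G) w (m := 1)) (adj G') f &
    forall u, u != inl w ->
      leaf_degree (graft (adj G) w (m := 1)) u <
      leaf_degree (graft (adj G) w (m := 1)) (inl w)]).
split=> [G tG|G H G' H' [v [[f fi] vmax]] [w [[g gi] wmax]]].
  have v0 : 'I_n by apply: (@Ordinal _ 0); apply: ltnW.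
  have [v vmax] : exists v, forall u,
      leaf_degree (adj G) u <= leaf_degree (adj G) v.
    case: (@arg_maxnP _ v0 predT (leaf_degree (adj G)) isT) => v _ vmax.
    by exists v => u; apply: vmax.
  by have [G1 [tG1 RG1]] := add_leaf tG n_gt1 vmax; exists G1.
move=> /isomorphicP[h hi]; apply/isomorphicP.
have [g' g'i _] := rel_iso_inv gi.
have Fi := rel_iso_comp (rel_iso_comp fi hi) g'i.
have gsym : symmetric (adj H) by apply: adj_sym.
apply: (graft_leaf_cancel (v := v) (w := w) (erefl _) gsym Fi).
have [F' F'i [FK F'K]] := rel_iso_inv Fi.
apply/eqP/negPn/negP => ne; have := wmax _ ne.
rewrite (rel_iso_leaf_degree _ Fi) -[X in _ < X](rel_iso_leaf_degree _ F'i).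
move=> lt; have ne' : F' (inl w) != inl v.
  by apply: contraNneq ne => <-; rewrite F'K.
by have := vmax _ ne'; rewrite ltnNge ltnW.
Qed.

Lemma embeds_grow n m : 1 < n -> n <= m ->
  @embeds n m (fun G => is_tree G) (fun G => is_tree G).
Proof.
move=> n_gt1; elim: m => [|m IH]; first by move=> /(leq_trans n_gt1).
rewrite leq_eqVlt => /orP[/eqP<-|le_nm]; first exact: embeds_refl.
have m_gt1 : 1 < m by exact: leq_trans n_gt1 le_nm.
by rewrite -addn1; apply: embeds_trans (IH le_nm) (embeds_add_leaf m_gt1).
Qed.

(** * Near-spiders of radius two *)

(** For [s = 1] every branch that reaches the rim is a bare path, so a
    near-spider is determined by its order and its number of legs: strip the
    legs until a star is left. *)
Lemma centre1_iso r n (G H : sgraph 'I_n) c b :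
  is_tree G -> is_tree H -> centre G 1 c -> centre H 1 b ->
  #|rim G 1 c| = r -> #|rim H 1 b| = r -> pointed_iso (adj G) c (adj H) b.
Proof.
elim: r n G H c b => [|r IH] n G H c b tG tH cG cH rG rH.
  have star (K : sgraph 'I_n) a : is_tree K -> #|rim K 1 a| = 0 ->
      forall x y, adj K x y = (x != y) && ((x == a) || (y == a)).
    move=> tK /cards0_eq rK; have conK : connected K by case/andP: tK.
    have le1 x : gdist K a x <= 1.
      by have /setP/(_ x) := rK; rewrite !inE gdistC // ltnNge => /negbFE.
    have adja x : adj K a x = (x != a).
      rewrite -gdist_adj // eqn_leq le1 lt0n gdist_eq0 // eq_sym.
      by [].
    move=> x y; have [->|xy] /= := eqVneq x y; first by rewrite adj_irrefl.
    have [xa|xa] := eqVneq x a; first by rewrite xa adja -xa eq_sym.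
    have [ya|ya] := eqVneq y a; first by rewrite ya adj_sym adja -ya.
    apply/negP => /(adj_gdist_neq tK a).
    have d1 z : z != a -> gdist K a z = 1.
      by rewrite -adja -gdist_adj // => /eqP.
    by rewrite !d1.
  exists (tperm c b); last by rewrite tpermL.
  split=> [|x y]; first exact: injF_bij perm_inj.
  have to_b z : (tperm c b z == b) = (z == c).
    by rewrite -[X in _ == X](tpermL c b) (inj_eq perm_inj).
  by rewrite (star _ _ tG rG) (star _ _ tH rH) (inj_eq perm_inj) !to_b.
have leg (K : sgraph 'I_n) a : is_tree K -> centre K 1 a -> #|rim K 1 a| = r.+1 ->
    exists x, [/\ adj K x a, beyond K 1 x a != set0 & #|side K x a| = 2].
  move=> tK cK rK; have /card_gt0P[v vR] : 0 < #|rim K 1 a| by rewrite rK.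
  have [x xa vx] := branch_exists tK (rim_neq tK vR).
  have B0 : beyond K 1 x a != set0.
    by apply/set0Pn; exists v; apply: mem_beyond.
  exists x; split=> //; apply/eqP; rewrite eqn_leq (branch_card tK xa B0) andbT.
  have conK : connected K by case/andP: tK.
  apply: (@leq_trans #|x |: beyond K 1 x a|).
    apply: subset_leq_card; apply/subsetP => u ux; rewrite in_setU1.
    by rewrite (beyondE _ tK) // ux lt0n gdist_eq0 // orbN.
  by rewrite cardsU1 -[2]/(1 + 1) leq_add ?leq_b1 ?cK.
have [x [xc xB xs]] := leg G c tG cG rG.
have [y [yb yB ys]] := leg H b tH cH rH.
have cardn : #|'I_n| = (n - 2) + 2.
  by rewrite card_ord subnK // -xs -[X in _ <= X]card_ord max_card.
have [G' [c' [tG' cG' gG rG' _]]] := strip_leg tG cG xc xB xs cardn.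
have [H' [b' [tH' cH' gH rH' _]]] := strip_leg tH cH yb yB ys cardn.
apply: grafted_iso gG gH _; apply: IH => //.
  by move: rG'; rewrite rG => -[].
by move: rH'; rewrite rH => -[].
Qed.

(** The spider on four vertices is a star for legs of length one, and a path
    when the initial path takes up all vertices. *)
Lemma two_trees_on_four : exists A B : sgraph 'I_(2 ^ 2),
  [/\ is_tree A, is_tree B & ~~ isomorphic A B].
Proof.
exists (spider 0 4), (spider 3 4); split; try exact: spider_is_tree.
apply/existsP => -[p /forallP hp].
have adj_star (y : 'I_4) : y != ord0 -> adj (spider 3 4) (p ord0) (p y).
  have /forallP/(_ y)/eqP -> := hp ord0; rewrite adj_spider /spider_rel.
  by rewrite /spider_parent modn1 eqxx eq_sym => ->.
have surj (z : 'I_4) : z != p ord0 -> adj (spider 3 4) (p ord0) z.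
  move=> ne; rewrite -(permKV p z); apply: adj_star.
  by apply: contraNneq ne => <-; rewrite permKV.
move: surj; move: (p ord0) => z surj.
have [lt_z|le_z] := ltnP z 2.
  have := surj (@Ordinal 4 3 isT); rewrite adj_spider /spider_rel -!val_eqE /=.
  by case: z lt_z {surj} => [[|[|]]] //= _ _ /(_ isT).
have := surj (@Ordinal 4 0 isT); rewrite adj_spider /spider_rel -!val_eqE /=.
by case: z le_z {surj} => [[|[|[|[|]]]]] //= _ _ /(_ isT).
Qed.

(** An open rim needs one vertex more, so the two bounds on the number of legs
    leave [n %/ 2 - 1] when the rim is open and [n %/ 2] when it is not. *)
Lemma embeds_near_spider1 n : 4 < n ->
  @embeds n (2 ^ 2) (fun G => exists c, near_spider 1 G c)
                    (fun G => is_tree G).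
Proof.
move=> n_gt4; have [A [B [tA tB nAB]]] := two_trees_on_four.
exists (fun G G' => exists c r, [/\ near_spider 1 G c, #|rim G 1 c| = r &
  (r.+1 = n %/ 2 /\ G' = A) \/ (r = n %/ 2 /\ G' = B)]).
split=> [G [c nG]|G H G' H' [c [r [nG rG GG']]] [b [l [nH rH HH']]] iso].
  have [tG cG] := nG; rewrite card_ord => rimG.
  have := @centre_card _ _ 1 c tG isT cG 2.
  rewrite card_ord => /(_ (fun x xc B0 => branch_card tG xc B0)) le_n.
  have nE := divn_eq n 2; have n2 := ltn_pmod n (isT : 0 < 2).
  have : #|rim G 1 c|.+1 = n %/ 2 \/ #|rim G 1 c| = n %/ 2.
    by move: rimG le_n nE n2; case: (open_rim G 1 c); clear; lia.
  by case=> e; [exists A | exists B] => //; exists c, #|rim G 1 c|; split; auto.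
have e : r = l.
  case: GG' iso => -[eG ->]; case: HH' => -[eH ->].
  - by move=> _; apply: succn_inj; rewrite eG eH.
  - by move/(negP nAB).
  - move=> /isomorphicP[f /rel_iso_inv[g gi _]]; case/negP: nAB.
    by apply/isomorphicP; exists g.
  - by rewrite eG eH.
have [tG cG _] := nG; have [tH cH _] := nH; apply/isomorphicP.
by have [|f fi _] := centre1_iso tG tH cG cH rG; [rewrite e | exists f].
Qed.

(** * Counting minimal trees *)

Lemma embeds_near_spider s n : 0 < s -> s.*2 ^ 2 < n ->
  @embeds n (s.*2 ^ 2) (fun G => exists c, near_spider s G c)
                       (fun G => is_tree G).
Proof.
case: s => [//|[|s]] _; first exact: embeds_near_spider1.
set t := s.+2; have t2 : t.*2 <= t.*2 ^ 2 by rewrite leq_pmulr.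
suff step m : 1 < m -> @embeds m (t.*2 ^ 2)
    (fun G => exists c, near_spider t G c) (fun G => is_tree G).
  by move=> lt_n; apply: step; apply: leq_ltn_trans lt_n; apply: leq_trans t2.
have [l] := ubnP m; elim: l m => // l IH m le_m m_gt1.
have [le_mt|lt_tm] := leqP m (t.*2 ^ 2).
  by apply: embeds_sub (embeds_grow m_gt1 le_mt) => G [c []].
have lt_m : t.+2 < m.
  by apply: leq_trans lt_tm; rewrite ltnS; apply: leq_trans t2; rewrite /t; lia.
rewrite -(@subnK t.+1 m) in lt_tm *; last by lia.
apply: embeds_trans (embeds_strip _ lt_tm) _ => //.
by apply: IH; lia.
Qed.

Lemma minimal_near_spider s n (G : sgraph 'I_n) : 0 < s -> s.*2 ^ 2 < n ->
  minimal_tree s.*2 G -> exists c, near_spider s G c.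
Proof.
move=> s_gt0 lt_n /andP[tG /forallP min].
have le_n : s.+1.*2 <= n.
  by apply: leq_trans lt_n; rewrite -!mul2n expnMn; nia.
apply: few_mdis_near_spider => //; first by rewrite card_ord.
have n_gt0 : 0 < n by apply: leq_trans lt_n.
have /implyP/(_ (spider_is_tree s n_gt0)) le_spider := min (spider s n).
have lt_sn : s < n by move: le_n; clear; lia.
by rewrite card_ord; apply: leq_trans (spider_mdis n_gt0 lt_sn); rewrite leq_add2r.
Qed.

Theorem theorem2 (n k : nat) (hn : 2 <= n) (hk : 2 <= k) (k_even : ~~ odd k)
    (trees : {set sgraph 'I_n})
    (trees_minimal : forall G, G \in trees -> minimal_tree k G)
    (trees_noniso : forall G H,
       G \in trees -> H \in trees -> G != H -> ~~ isomorphic G H) :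
  #|trees| <= num_trees (k ^ 2).
Proof.
have kE : k = k./2.*2 by rewrite -{1}(odd_double_half k) (negPf k_even).
have [le_nk|lt_kn] := leqP n (k ^ 2).
  apply: embeds_card (embeds_grow hn le_nk) _ trees_noniso.
  by move=> G /trees_minimal/andP[].
have s_gt0 : 0 < k./2 by rewrite half_gt0.
move: (k./2) kE s_gt0 => s kE s_gt0; subst k.
apply: embeds_card (embeds_near_spider s_gt0 lt_kn) _ trees_noniso.
by move=> G /trees_minimal; apply: minimal_near_spider.
Qed.
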